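(* For each odd integer $L\ge3$, let $S$ be the SRRW on the cyclic group $(\mathbb{Z}_L,+)$ with step distribution $\mu(1)=\mu(-1)=1/2$ and reinforcement parameter $\alpha\in[0,1)$, and let $t^{(\alpha)}_{\mathrm{mix}}(\varepsilon)$ (depending on $L$) be its $\varepsilon$-mixing time. Fix $\varepsilon\in(0,1)$. (i) If $\alpha\in[0,1/2)$, there exist positive constants $c_1=c_1(\alpha,\varepsilon)$ and $C_1=C_1(\alpha,\varepsilon)$ such that for all sufficiently large odd $L$, $$c_1L^2\le t^{(\alpha)}_{\mathrm{mix}}(\varepsilon)\le C_1L^2.$$ (ii) If $\alpha=1/2$, there exist positive constants $c_2=c_2(\varepsilon)$ and $C_2=C_2(\varepsilon)$ such that for all sufficiently large odd $L$, $$\frac{c_2L^2}{\log L}\le t^{(\alpha)}_{\mathrm{mix}}(\varepsilon)\le\frac{C_2L^2}{\log L}.$$ (iii) If $\alpha\in(1/2,1)$, there exist positive constants $c_3=c_3(\alpha,\varepsilon)$ and $C_3=C_3(\alpha,\varepsilon)$ such that for all sufficiently large odd $L$, $$c_3L^{1/\alpha}\le t^{(\alpha)}_{\mathrm{mix}}(\varepsilon)\le C_3L^{1/\alpha}.$$ Moreover, for every fixed $\alpha\in[0,1)$, this family of walks (indexed by odd $L$) does not exhibit cutoff as $L\to\infty$ through odd integers.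
   Context: SRRW: Let $(G,\cdot)$ be a discrete group with $|G|\ge2$ and identity $e_G$, $\mu$ a probability measure on $G$, and $\alpha\in[0,1)$. Let $(\xi_n)_{n\ge2}$ be i.i.d. Bernoulli random variables with $\mathbb{P}(\xi_n=1)=\alpha$, and let $(u_n)_{n\ge2}$ be independent with $u_n$ uniform on $\{1,\dots,n-1\}$; these two sequences and all fresh samples from $\mu$ below are independent. Set $S_0=e_G$; sample $X_1$ from $\mu$ and set $S_1=X_1$. For $n>1$: if $\xi_n=1$ set $X_n=X_{u_n}$; if $\xi_n=0$ sample $X_n$ afresh from $\mu$; put $S_n=S_{n-1}\cdot X_n$. The process $(S_n)$ is the SRRW on $G$ (started at $e_G$) with step distribution $\mu$ and reinforcement parameter $\alpha$. Mixing time: with $U$ the uniform measure on the finite group $G$ and $\|\nu_1-\nu_2\|_{\mathrm{TV}}=\frac12\sum_{g\in G}|\nu_1(g)-\nu_2(g)|$, $$t^{(\alpha)}_{\mathrm{mix}}(\varepsilon)=\inf\{n\ge1:\ \|\mathbb{P}(S_m=\cdot)-U\|_{\mathrm{TV}}\le\varepsilon\ \text{ for all } m\ge n\}.$$ Cutoff: a family of walks indexed by $L$ has a cutoff as $L\to\infty$ if $\lim_{L\to\infty} t^{(\alpha)}_{\mathrm{mix}}(\varepsilon)/t^{(\alpha)}_{\mathrm{mix}}(1-\varepsilon)=1$ for every $\varepsilon\in(0,1)$. *)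

(* Defs.v *)
From HB Require Import structures.
From mathcomp Require Import all_boot all_order all_algebra all_fingroup.
From mathcomp Require Import finmap.
From mathcomp Require Import all_classical all_reals all_analysis.

Set Implicit Arguments.
Unset Strict Implicit.
Unset Printing Implicit Defensive.

Import Order.TTheory GRing.Theory Num.Theory.
Import numFieldNormedType.Exports.

Local Open Scope classical_set_scope.
Local Open Scope ring_scope.

(* The sigma-algebra generated by a random element [X] of a discrete space. *)
Definition events_of (T V : Type) (X : T -> V) : set (set T) :=
  preimage_set_system setT X [set: set V].

Definition mutually_independent (d : measure_display) (T : measurableType d)
    (R : realType) (P : probability T R) (I : choiceType)
    (F : I -> set (set T)) : Prop :=
  forall (J : {fset I}) (E : I -> set T),
    (forall i, i \in J -> F i (E i)) ->
    P (\bigcap_(i in [set` J]) E i) = (\prod_(i <- J) P (E i))%E.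

Definition srrw_sources (T : Type) (G : Type) (xi : nat -> T -> bool)
    (u : nat -> T -> nat) (Y : nat -> T -> G) (i : nat + nat + nat) :
    set (set T) :=
  match i with
  | inl (inl n) => events_of (xi n.+2)
  | inl (inr n) => events_of (u n.+2)
  | inr n => events_of (Y n.+1)
  end.

(* A step-reinforced random walk, on some probability space. The sample [Y n]
   is the fresh step at time n; it is defined for every n but ignored when
   [xi n] holds. The entry at 0 of each sequence is irrelevant, as are those
   at 1 of [srrw_xi] and [srrw_u]. *)
Record srrw (R : realType) (G : finGroupType) (mu : G -> R) (alpha : R) :=
  Srrw {
  srrw_disp : measure_display;
  srrw_space : measurableType srrw_disp;
  srrw_P : probability srrw_space R;
  srrw_xi : nat -> srrw_space -> bool;
  srrw_u : nat -> srrw_space -> nat;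
  srrw_Y : nat -> srrw_space -> G;
  srrw_X : nat -> srrw_space -> G;
  srrw_measurable : forall i,
    srrw_sources srrw_xi srrw_u srrw_Y i `<=` measurable;
  srrw_indep :
    mutually_independent srrw_P (srrw_sources srrw_xi srrw_u srrw_Y);
  srrw_xi_law : forall n, (2 <= n)%N ->
    srrw_P (srrw_xi n @^-1` [set true]) = alpha%:E;
  srrw_u_range : forall n w, (2 <= n)%N -> (1 <= srrw_u n w < n)%N;
  srrw_u_law : forall n k, (2 <= n)%N -> (1 <= k < n)%N ->
    srrw_P (srrw_u n @^-1` [set k]) = (n.-1%:R^-1)%:E;
  srrw_Y_law : forall n g, (1 <= n)%N ->
    srrw_P (srrw_Y n @^-1` [set g]) = (mu g)%:E;
  srrw_X1 : forall w, srrw_X 1 w = srrw_Y 1 w;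
  srrw_Xn : forall n w, (2 <= n)%N ->
    srrw_X n w = if srrw_xi n w then srrw_X (srrw_u n w) w else srrw_Y n w
}.

Section Walk.
Variables (R : realType) (G : finGroupType) (mu : G -> R) (alpha : R).
Variable W : srrw mu alpha.

Fixpoint srrw_S (n : nat) (w : srrw_space W) : G :=
  if n is m.+1 then (srrw_S m w * srrw_X n w)%g else 1%g.

Definition srrw_law (n : nat) (g : G) : R :=
  fine (srrw_P W (srrw_S n @^-1` [set g])).

End Walk.

Definition uniform_pmf (R : realType) (G : finType) (g : G) : R := #|G|%:R^-1.

Definition total_variation_dist (R : realType) (G : finType) (nu1 nu2 : G -> R)
  : R := 2^-1 * \sum_(g : G) `|nu1 g - nu2 g|.

(* Extended-real valued, so that the infimum of the empty set is +oo. *)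
Definition mixing_time (R : realType) (G : finGroupType) (mu : G -> R)
    (alpha : R) (W : srrw mu alpha) (eps : R) : \bar R :=
  ereal_inf [set n%:R%:E | n in [set n : nat | (1 <= n)%N /\
    forall m, (n <= m)%N ->
      total_variation_dist (srrw_law W m) (@uniform_pmf R G) <= eps]].

(* [t k eps] is the [eps]-mixing time of the [k]-th walk of the family. *)
Definition has_cutoff (R : realType) (t : nat -> R -> \bar R) : Prop :=
  forall eps : R, 0 < eps < 1 ->
    (t k eps / t k (1 - eps)%R)%E @[k --> \oo] --> 1%E.

(* The group law of ['Z_L] as a [finGroupType] is addition. For L >= 3 the
   points 1 and -1 are distinct, so each has mass 1/2. *)
Definition pm1_step (R : realType) (L : nat) (x : 'Z_L) : R :=
  ((x == 1)%:R + (x == -1)%:R) / 2.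

Definition cyclic_srrw (R : realType) (L : nat) (alpha : R) :=
  srrw (@pm1_step R L) alpha.

(* Main.v *)
Require Import Defs.
From HB Require Import structures.
From mathcomp Require Import all_boot all_order all_algebra all_fingroup.
From mathcomp Require Import finmap.
From mathcomp Require Import all_classical all_reals all_analysis.
From mathcomp Require Import ring lra zify.

Set Implicit Arguments.
Unset Strict Implicit.
Unset Printing Implicit Defensive.

Import Order.TTheory GRing.Theory Num.Theory.
Import numFieldNormedType.Exports.

Local Open Scope classical_set_scope.
Local Open Scope ring_scope.

(** Every step of the walk repeats one fresh sample, its root. Grouping the
    steps by root splits the first n steps into clusters; if N_b is the number
    of steps rooted at b, then S_n is the sum of the N_b Y_b, where the fresh
    signs Y_b are independent of the clusters. Hence the Fourier coefficient of
    S_n at the frequency theta is the mean of the product over b of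
    cos(theta N_b), and the whole problem is about cluster sizes. A cluster
    born at time b has size of order (n/b)^alpha at time n, so the sum of the
    N_b^2 is of order n, n log n or n^(2 alpha) according to whether alpha is
    below, at or above 1/2. Mixing happens when this sum reaches L^2.

    Upper bound. By Plancherel (chi2E) and Cauchy-Schwarz, the squared
    L2-distance to uniformity is at most the sum over the nontrivial
    frequencies of the mean of the product of the cos^2(theta N_b) (sqr_char).
    For L odd the frequencies can be listed so that cos^2(theta_k j) equals
    cos^2(pi k j / L), so only small frequencies matter. Since cos^2 is at most
    exp(-sin^2), it suffices that the sum of the sin^2(theta N_b) be large with
    high probability. Bound sin^2(theta j) from below by a combination of two
    rising factorials j(j+1)...(j+k-1). These are the eigenfunctions of
    cluster growth: a cluster grows at a rate proportional to its size, so the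
    mean of its k-th rising factorial is multiplied by 1 + alpha k / t at time
    t. Moreover distinct clusters compete for each step, hence are negatively
    correlated, and the variance of a sum of k-th rising factorials is at most
    the mean of the sum of the (2k)-th ones (Ecluster_moment_var). Chebyshev's
    inequality concludes (char_fun_moment_bound). To prevent the largest
    clusters, where theta N_b wraps around the circle, from dominating the
    moments, only the clusters born in a window [m, n) are kept: m is close
    to n for large frequencies (sqr_char_bound_all), and is the time such that
    theta (n/m)^alpha is a small constant for small ones
    (sqr_char_bound_window). In each regime the k-th term turns out to be at
    most a multiple of (sc(L)/n) k^(-p) with p > 1, where sc(L) is the order of
    the mixing time; summing, the squared distance is at most a multiple of sc(L)/n
    (mixing_scale).

    Lower bound. The mean of 1 - cos(2 pi S_n / L) is at most a multiple of
    the mean of the sum of the N_b^2 divided by L^2. If n is a small multiple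
    of sc(L) this is small, so S_n is concentrated on a short arc and the total
    variation distance is close to 1 (tv_lower_bound).

    No cutoff. A probability measure at bounded L2-distance from the uniform
    one has total variation distance bounded away from 1 (tv_le_overlap). So
    for every eta there is an eps such that the (1 - eps)-mixing time is at
    most eta sc(L), whereas the eps-mixing time is at least c sc(L) with c
    independent of eps at most 1/2; taking eta = c/2, the ratio of the two
    times is at least 2 for all large L (no_cutoff). *)

(** * Random roots and fresh samples *)

Section Roots.
Variables (R : realType) (alpha : R).

Definition fresh_prob (t : nat) : R := if t is 0 then 1 else 1 - alpha.

(** Expectation over the list of the roots of the first n steps. Steps are
    numbered from 0 here. Repeating a uniformly chosen earlier step amounts to
    appending a uniform entry of the list; at t = 0 the list is empty and
    the second term vanishes. *)
Fixpoint Eroots (n : nat) (F : seq nat -> R) : R :=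
  if n is t.+1 then
    Eroots t (fun s => fresh_prob t * F (rcons s t)
                       + alpha / t%:R * \sum_(x <- s) F (rcons s x))
  else F [::].

End Roots.

Section Fresh.
Variables (R : realType) (G : finType) (mu : G -> R).

Fixpoint Efresh (n : nat) (F : seq G -> R) : R :=
  if n is t.+1 then Efresh t (fun y => \sum_g mu g * F (rcons y g)) else F [::].

End Fresh.

(** Law of the choice made at step t, encoded as a number: 0 for a fresh sample,
    and c > 0 for the repetition of the c-th step. *)
Definition choice_prob (R : realType) (alpha : R) (t c : nat) : R :=
  if c == 0%N then fresh_prob alpha t else alpha / t%:R.

(** * From the probability space to finite sums *)

Section Cylinder.
Variables (R : realType) (G : finGroupType) (mu : G -> R) (alpha : R).
Variable W : srrw mu alpha.
Local Notation P := (srrw_P W).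

Definition choice_of (t : nat) (w : srrw_space W) : nat :=
  if (t == 0%N) || ~~ srrw_xi t.+1 w then 0%N else srrw_u t.+1 w.

(** A fresh choice puts no constraint on u, whence the full event. *)
Definition cylinder_event (c : nat -> nat) (y : nat -> G) (i : nat + nat + nat) :
    set (srrw_space W) :=
  match i with
  | inl (inl k) => srrw_xi k.+2 @^-1` [set c k.+1 != 0%N]
  | inl (inr k) => if c k.+1 == 0%N then setT else srrw_u k.+2 @^-1` [set c k.+1]
  | inr k => srrw_Y k.+1 @^-1` [set y k]
  end.

Definition cylinder_index (n : nat) : seq (nat + nat + nat) :=
  [seq inl (inl k) | k <- iota 0 n] ++ [seq inl (inr k) | k <- iota 0 n]
    ++ [seq inr k | k <- iota 0 n.+1].

Lemma cylinder_index_uniq n : uniq (cylinder_index n).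
Proof.
rewrite /cylinder_index !cat_uniq; move: (iota 0 n.+1) (iota_uniq 0 n.+1) => l ul.
rewrite !map_inj_uniq ?iota_uniq ?ul /=; first last; try by move=> ? ? [].
rewrite andbT; apply/andP; split; apply/hasPn => i.
- by rewrite mem_cat => /orP[] /mapP[k _ ->]; apply/negP; case/mapP.
- by move=> /mapP[k _ ->]; apply/negP; case/mapP.
Qed.

Lemma cylinder_bigcap n c y :
  (forall t, (t <= n)%N -> (c t <= t)%N) ->
  \bigcap_(i in [set` seq_fset tt (cylinder_index n)]) cylinder_event c y i =
  [set w | forall t, (t < n.+1)%N -> choice_of t w = c t /\ srrw_Y t.+1 w = y t].
Proof.
move=> cle.
have HJ i : [set` seq_fset tt (cylinder_index n)] i <-> i \in cylinder_index n.
  by rewrite /mkset seq_fsetE.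
apply/seteqP; split => w.
- move=> H t; rewrite ltnS => tn; split; last first.
    apply: (H (inr t)); apply/HJ; rewrite !mem_cat [X in _ || (_ || X)]map_f ?orbT //.
    by rewrite mem_iota.
  case: t tn => [|t] tn; first by have /= := cle _ tn; case: (c 0%N).
  have Hm : t \in iota 0 n by rewrite mem_iota.
  have Hx : cylinder_event c y (inl (inl t)) w.
    by apply: H; apply/HJ; rewrite mem_cat map_f.
  have Hu : cylinder_event c y (inl (inr t)) w.
    by apply: H; apply/HJ; rewrite !mem_cat [X in _ || (X || _)]map_f ?orbT.
  move: Hx Hu; rewrite /choice_of /= => ->.
  by case: eqP => [->|].
- move=> H i /HJ; rewrite !mem_cat => /orP[|/orP[]] /mapP[k];
    rewrite mem_iota add0n => /= kn ->; rewrite /=.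
  + have [] := H k.+1 kn; rewrite /choice_of /= => <- _.
    have /andP[] := srrw_u_range (n := k.+2) w isT.
    by case: srrw_xi => //=; case: srrw_u.
  + case: eqP => // /eqP ck0; have [] := H k.+1 kn; rewrite /choice_of /=.
    by case: srrw_xi => //= ck; rewrite -ck in ck0.
  + by have [] := H k kn.
Qed.

Lemma cylinder_event_measurable c y i : measurable (cylinder_event c y i).
Proof.
suff : srrw_sources (srrw_xi (s := W)) (srrw_u (s := W)) (srrw_Y (s := W)) i
  (cylinder_event c y i) by apply: srrw_measurable.
case: i => [[k|k]|k] /=.
- by exists [set c k.+1 != 0%N]; rewrite // setTI.
- case: ifP => _; first by exists setT; rewrite // setTI.
  by exists [set c k.+1]; rewrite // setTI.
- by exists [set y k]; rewrite // setTI.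
Qed.

(** Mutual independence of the sources gives the joint law of the choices and
    of the fresh samples up to any time. *)
Lemma cylinder_prob n c y :
  (forall t, (t <= n)%N -> (c t <= t)%N) ->
  P [set w | forall t, (t < n.+1)%N -> choice_of t w = c t /\ srrw_Y t.+1 w = y t]
  = (\prod_(t < n.+1) (choice_prob alpha t (c t) * mu (y t)))%:E.
Proof.
move=> cle; rewrite -(cylinder_bigcap y cle) (srrw_indep (s := W)); last first.
  move=> [[k|k]|k] _ /=.
  - by exists [set c k.+1 != 0%N]; rewrite // setTI.
  - case: ifP => _; first by exists setT; rewrite // setTI.
    by exists [set c k.+1]; rewrite // setTI.
  - by exists [set y k]; rewrite // setTI.
rewrite (perm_big (cylinder_index n)); last first.
  have := seq_fset_perm tt (cylinder_index n).
  by rewrite undup_id ?cylinder_index_uniq.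
rewrite /cylinder_index !big_cat !big_map.
have Exi k : (k < n)%N -> P (srrw_xi k.+2 @^-1` [set c k.+1 != 0%N]) =
    (if c k.+1 == 0%N then 1 - alpha else alpha)%:E.
  move=> kn; case: eqP => /= _; last by rewrite srrw_xi_law.
  rewrite (_ : _ @^-1` _ = ~` (srrw_xi k.+2 @^-1` [set true])); last first.
    by apply/seteqP; split => w /=; case: srrw_xi.
  rewrite probability_setC ?srrw_xi_law //.
  exact: (cylinder_event_measurable (fun=> 1%N) (fun=> 1%g) (inl (inl k))).
have Eu k : (k < n)%N ->
    P (if c k.+1 == 0%N then setT else srrw_u k.+2 @^-1` [set c k.+1]) =
    (if c k.+1 == 0%N then 1 else k.+1%:R^-1)%:E.
  move=> kn; case: eqP => /= [_|/eqP ck]; first by rewrite probability_setT.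
  by rewrite srrw_u_law //= ltnS cle // lt0n ck.
have E1 : (\prod_(j <- iota 0 n) P (srrw_xi j.+2 @^-1` [set c j.+1 != 0%N])
    = (\prod_(j <- iota 0 n) (if c j.+1 == 0%N then 1 - alpha else alpha))%:E)%E.
  rewrite -prodEFin; apply: eq_big_seq => k; rewrite mem_iota add0n => kn.
  by rewrite Exi.
have E2 : (\prod_(j <- iota 0 n) P (if c j.+1 == 0%N then setT else srrw_u j.+2 @^-1` [set c j.+1])
    = (\prod_(j <- iota 0 n) (if c j.+1 == 0%N then 1 else j.+1%:R^-1))%:E)%E.
  rewrite -prodEFin; apply: eq_big_seq => k; rewrite mem_iota add0n => kn.
  by rewrite Eu.
have E3 : (\prod_(j <- iota 0 n.+1) P (srrw_Y j.+1 @^-1` [set y j])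
    = (\prod_(j <- iota 0 n.+1) mu (y j))%:E)%E.
  rewrite -prodEFin; apply: eq_big_seq => k _.
  by rewrite srrw_Y_law.
have /= -> := congr2 (@mule R) E1 (congr2 (@mule R) E2 E3).
rewrite -!EFinM; congr (_%:E).
rewrite mulrA -big_split /= -!(big_mkord xpredT (fun t => choice_prob alpha t (c t) * mu (y t))).
rewrite [RHS]big_split; congr (_ * _) => /=.
rewrite big_ltn // /choice_prob.
have -> /= : c 0%N = 0%N by have := cle 0%N isT; case: (c 0%N).
rewrite mul1r big_add1 /= /index_iota subn0; apply: eq_bigr => k _.
by case: eqP => _ /=; rewrite ?mulr1.
Qed.

End Cylinder.

Section Histories.
Variables (R : realType) (G : finGroupType) (mu : G -> R) (alpha : R).

Definition step_choices (t : nat) : seq (nat * G) :=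
  [seq (c, g) | c <- iota 0 t.+1, g <- enum G].

Fixpoint histories (n : nat) : seq (seq (nat * G)) :=
  if n is t.+1 then [seq rcons h x | h <- histories t, x <- step_choices t]
  else [:: [::]].

Definition history_weight (h : seq (nat * G)) : R :=
  \prod_(t < size h)
    (choice_prob alpha t (nth (0%N, 1%g) h t).1 * mu (nth (0%N, 1%g) h t).2).

(** A history lists the choices and the fresh samples of the first steps; the
    list of all histories is finite, so that expectations are finite sums. *)
Definition Ehistory (n : nat) (F : seq (nat * G) -> R) : R :=
  \sum_(h <- histories n) history_weight h * F h.

Lemma size_histories n h : h \in histories n -> size h = n.
Proof.
elim: n h => [|n IH] h /=; first by rewrite inE => /eqP ->.
by case/allpairsP => -[h' x] /= [/IH <- _ ->]; rewrite size_rcons.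
Qed.

Lemma histories_choice n h t : h \in histories n -> (t < n)%N ->
  ((nth (0%N, 1%g) h t).1 <= t)%N.
Proof.
elim: n h => [|n IH] h //= /allpairsP[[h' x]] /= [hh xin ->].
rewrite ltnS leq_eqVlt nth_rcons (size_histories hh) => /predU1P[->|tn].
  rewrite ltnn eqxx; case/allpairsP: xin => cg [cin _ ->].
  by move: cin; rewrite mem_iota ltnS.
by rewrite tn; apply: IH.
Qed.

Lemma histories_uniq n : uniq (histories n).
Proof.
elim: n => //= n IH; apply: allpairs_uniq => //.
  apply: allpairs_uniq; [exact: iota_uniq|exact: enum_uniq|].
  by move=> [? ?] [? ?] /= _ _ [-> ->].
by move=> [h x] [h' x'] /= _ _ /rcons_inj[-> ->].
Qed.

Lemma history_weight_rcons h x : history_weight (rcons h x) =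
  history_weight h * (choice_prob alpha (size h) x.1 * mu x.2).
Proof.
rewrite /history_weight size_rcons big_ord_recr /=; congr (_ * _).
  by apply: eq_bigr => t _; rewrite nth_rcons ltn_ord.
by rewrite nth_rcons ltnn eqxx.
Qed.

Lemma Ehistory_S n F : Ehistory n.+1 F =
  Ehistory n (fun h => \sum_(c < n.+1) choice_prob alpha n c *
                          \sum_g mu g * F (rcons h (c : nat, g))).
Proof.
rewrite /Ehistory /= big_allpairs_dep /=.
apply: eq_big_seq => h hh; rewrite big_allpairs_dep /=.
rewrite -[0%N :: iota 1 n]/(index_iota 0 n.+1) big_mkord mulr_sumr; apply: eq_bigr => c _.
rewrite big_enum /= !mulr_sumr; apply: eq_bigr => g _.
by rewrite history_weight_rcons (size_histories hh) /=; ring.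
Qed.

Variable W : srrw mu alpha.
Local Notation P := (srrw_P W).

Definition history (n : nat) (w : srrw_space W) : seq (nat * G) :=
  mkseq (fun t => (choice_of t w, srrw_Y t.+1 w)) n.

Lemma choice_of_le t w : (choice_of (W := W) t w <= t)%N.
Proof.
rewrite /choice_of; case: t => [|t] //=.
by case: ifP => // _; have /andP[_] := srrw_u_range (n := t.+2) w isT.
Qed.

Lemma history_in n w : history n w \in histories n.
Proof.
elim: n => //= n IH; rewrite /history mkseqS.
apply/allpairsP; exists (history n w, (choice_of n w, srrw_Y n.+1 w)); split => //=.
apply/allpairsP; exists (choice_of n w, srrw_Y n.+1 w).
by split; rewrite ?mem_iota ?mem_enum // ltnS choice_of_le.
Qed.

Lemma history_event n h : h \in histories n.+1 ->
  measurable [set w | history n.+1 w = h] /\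
  P [set w | history n.+1 w = h] = (history_weight h)%:E.
Proof.
move=> hh; have sh := size_histories hh.
pose c t := (nth (0%N, 1%g : G) h t).1; pose y t := (nth (0%N, 1%g : G) h t).2.
have cle t : (t <= n)%N -> (c t <= t)%N by rewrite -ltnS; apply: histories_choice.
have -> : [set w | history n.+1 w = h] =
    [set w | forall t, (t < n.+1)%N -> choice_of t w = c t /\ srrw_Y t.+1 w = y t].
  apply/seteqP; split => w /=.
    by move=> E t tn; rewrite /c /y -E nth_mkseq.
  move=> E; apply: (@eq_from_nth _ (0%N, 1%g)); first by rewrite size_mkseq sh.
  move=> t; rewrite size_mkseq => tn; rewrite nth_mkseq //.
  by have [-> ->] := E t tn; rewrite /c /y -surjective_pairing.
split; last by rewrite cylinder_prob // /history_weight sh.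
rewrite -cylinder_bigcap //; apply: fin_bigcap_measurable => //.
by move=> i _; apply: cylinder_event_measurable.
Qed.

Lemma history_prob n (A : seq (nat * G) -> bool) :
  P [set w | A (history n.+1 w)] = (Ehistory n.+1 (fun h => (A h)%:R))%:E.
Proof.
rewrite (_ : [set _ | _] =
    \bigcup_(h in [set` [seq h <- histories n.+1 | A h]])
       [set w | history n.+1 w = h]); last first.
  apply/seteqP; split => w /=.
    by move=> Aw; exists (history n.+1 w); rewrite //= mem_filter Aw history_in.
  by case=> h /=; rewrite mem_filter => /andP[Ah _] ->.
rewrite measure_fin_bigcup; first last.
- by move=> h /=; rewrite mem_filter => /andP[_ /history_event[]].
- by move=> h h' _ _ [w [/= -> ->]].
- exact: finite_seq.
rewrite -fsbig_seq ?filter_uniq ?histories_uniq // big_filter.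
rewrite /Ehistory -sumEFin big_mkcond /=; apply: eq_big_seq => h hh.
case: ifP => _; last by rewrite mulr0.
by rewrite mulr1; have [] := history_event hh.
Qed.

End Histories.

(** The root of a step, computed from the roots of the earlier ones; choices
    other than 0 are 1-based, whence the predecessor. *)
Definition next_root (s : seq nat) (c : nat) : nat :=
  if c == 0%N then size s else nth 0%N s c.-1.

Definition roots (c : seq nat) : seq nat :=
  foldl (fun s x => rcons s (next_root s x)) [::] c.

Lemma roots_rcons c x : roots (rcons c x) = rcons (roots c) (next_root (roots c) x).
Proof. by rewrite /roots foldl_rcons. Qed.

Lemma size_roots c : size (roots c) = size c.
Proof. by elim/last_ind: c => // c x IH; rewrite roots_rcons !size_rcons IH. Qed.

Section Factor.
Variables (R : realType) (alpha : R) (G : finGroupType) (mu : G -> R).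

Lemma eq_Eroots n F1 F2 :
  (forall s, size s = n -> all (ltn^~ n) s -> F1 s = F2 s) ->
  Eroots alpha n F1 = Eroots alpha n F2.
Proof.
elim: n F1 F2 => [|n IH] F1 F2 H /=; first exact: H.
have wk s x : (x < n.+1)%N -> all (ltn^~ n) s -> all (ltn^~ n.+1) (rcons s x).
  move=> xn sn; rewrite all_rcons /= xn /=.
  by apply: sub_all sn => z /= zn; apply: ltnW.
apply: IH => s ss sn; rewrite H ?size_rcons ?ss ?wk //; congr (_ + _ * _).
apply: eq_big_seq => x xs; rewrite H ?size_rcons ?ss ?wk //.
by move/allP: sn => /(_ _ xs) /= xn; apply: ltnW.
Qed.

Lemma eq_Efresh n F1 F2 : F1 =1 F2 -> Efresh mu n F1 = Efresh mu n F2.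
Proof. by move=> /funext ->. Qed.

Lemma EfreshZ n c F : Efresh mu n (fun y => c * F y) = c * Efresh mu n F.
Proof.
elim: n F => //= n IH F; rewrite -IH; apply: eq_Efresh => y.
by rewrite mulr_sumr; apply: eq_bigr => g _; rewrite mulrCA.
Qed.

Lemma Efresh_sum n (I : Type) (r : seq I) (F : I -> seq G -> R) :
  Efresh mu n (fun y => \sum_(i <- r) F i y) = \sum_(i <- r) Efresh mu n (F i).
Proof.
elim: n F => //= n IH F; rewrite -IH; apply: eq_Efresh => y.
by rewrite exchange_big /=; apply: eq_bigr => g _; rewrite mulr_sumr.
Qed.

(** The roots depend on the choices only, so the fresh samples can be averaged
    out first, the roots being fixed. *)
Lemma Ehistory_factor n (F : seq nat -> seq G -> R) :
  Ehistory mu alpha n (fun h => F (roots (unzip1 h)) (unzip2 h)) =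
  Eroots alpha n (fun s => Efresh mu n (F s)).
Proof.
elim: n F => [|n IH] F.
  by rewrite /Ehistory /= big_seq1 /history_weight big_ord0 mul1r.
rewrite Ehistory_S /=.
pose F' s y := \sum_(c < n.+1) choice_prob alpha n c *
   \sum_g mu g * F (rcons s (next_root s c)) (rcons y g).
transitivity (Ehistory mu alpha n (fun h => F' (roots (unzip1 h)) (unzip2 h))).
  apply: eq_bigr => h _; congr (_ * _); apply: eq_bigr => c _; congr (_ * _).
  apply: eq_bigr => g _; congr (_ * _).
  by rewrite /unzip1 /unzip2 !map_rcons roots_rcons.
rewrite IH; apply: eq_Eroots => s ss sn.
rewrite /F' Efresh_sum big_ord_recl /= EfreshZ; congr (_ * _ + _).
  by rewrite /next_root /= ss.
rewrite (big_nth 0%N) ss big_mkord mulr_sumr; apply: eq_bigr => c _.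
by rewrite EfreshZ.
Qed.

End Factor.

Section Law.
Variables (R : realType) (G : finGroupType) (mu : G -> R) (alpha : R).
Variable W : srrw mu alpha.

Definition walk_end (s : seq nat) (y : seq G) : G := (\prod_(r <- s) nth 1%g y r)%g.

(** Following the repetitions back to a fresh sample: by strong induction, each
    step equals the fresh sample at its root. *)
Lemma srrw_X_root n t w : (t < n)%N ->
  srrw_X (s := W) t.+1 w =
    srrw_Y (nth 0%N (roots (mkseq (fun t => choice_of t w) n)) t).+1 w /\
  (nth 0%N (roots (mkseq (fun t => choice_of t w) n)) t < n)%N.
Proof.
elim: n t => // n IH t; rewrite ltnS mkseqS roots_rcons nth_rcons size_roots size_mkseq.
have IH' k : (k < n)%N -> srrw_X (s := W) k.+1 w =
    srrw_Y (nth 0%N (roots (mkseq (fun t => choice_of t w) n)) k).+1 w /\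
  (nth 0%N (roots (mkseq (fun t => choice_of t w) n)) k < n.+1)%N.
  by move=> /IH [-> /ltnW].
rewrite leq_eqVlt => /predU1P[->|tn]; last by rewrite tn; apply: IH'.
rewrite ltnn eqxx /next_root size_roots size_mkseq.
case: n IH IH' => [|n] IH IH'; first by rewrite /choice_of /= srrw_X1.
rewrite srrw_Xn // /choice_of /=; case: ifP => //= xiw.
have /andP[] := srrw_u_range (n := n.+2) w isT.
by case: srrw_u => [|k] //= _; rewrite ltnS; apply: IH'.
Qed.

Lemma srrw_S_history n w : srrw_S n w =
  walk_end (roots (unzip1 (history (W := W) n w))) (unzip2 (history (W := W) n w)).
Proof.
have -> : unzip1 (history (W := W) n w) = mkseq (fun t => choice_of t w) n.
  by rewrite /history /unzip1 /mkseq -map_comp.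
have -> : unzip2 (history (W := W) n w) = mkseq (fun t => srrw_Y t.+1 w) n.
  by rewrite /history /unzip2 /mkseq -map_comp.
rewrite /walk_end; have sz := size_roots (mkseq (fun t => choice_of (W := W) t w) n).
rewrite size_mkseq in sz; rewrite (big_nth 0%N) sz big_mkord.
transitivity ((\prod_(t < n) srrw_X (s := W) t.+1 w)%g).
  by elim: n {sz} => [|n IH]; rewrite ?big_ord0 // big_ord_recr /= -IH.
apply: eq_bigr => t _; have [-> ?] := srrw_X_root w (ltn_ord t).
by rewrite nth_mkseq.
Qed.

(** The law of the walk is thus that of a purely finite model: random roots,
    then independent samples placed at the roots. *)
Lemma srrw_expectation n (h : G -> R) : (0 < n)%N ->
  \sum_g srrw_law W n g * h g =
  Eroots alpha n (fun s => Efresh mu n (fun y => h (walk_end s y))).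
Proof.
case: n => // n _.
have E g : srrw_law W n.+1 g = Ehistory mu alpha n.+1
    (fun h => (walk_end (roots (unzip1 h)) (unzip2 h) == g)%:R).
  rewrite /srrw_law (_ : _ @^-1` _ = [set w |
     walk_end (roots (unzip1 (history (W := W) n.+1 w)))
              (unzip2 (history (W := W) n.+1 w)) == g]); last first.
    by apply/seteqP; split => w; rewrite /preimage /mkset srrw_S_history => /eqP.
  by rewrite (history_prob W n (fun h => walk_end (roots (unzip1 h)) (unzip2 h) == g)).
rewrite -(Ehistory_factor alpha mu n.+1 (fun s y => h (walk_end s y))) /Ehistory.
under eq_bigr do rewrite E /Ehistory mulr_suml.
rewrite exchange_big /=; apply: eq_bigr => l _.
rewrite (bigD1 (walk_end (roots (unzip1 l)) (unzip2 l))) //= eqxx mulr1.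
rewrite big1 ?addr0 // => g gn; rewrite eq_sym (negbTE gn) mulr0 mul0r //.
Qed.

End Law.

(** * Moments of the cluster sizes *)

Definition rising (k j : nat) : nat := (\prod_(i < k) (j + i))%N.

Lemma rising0 k : (0 < k)%N -> rising k 0 = 0%N.
Proof. by case: k => // k _; rewrite /rising big_ord_recl mul0n. Qed.

Lemma rising1 k : rising k 1 = k`!.
Proof. by rewrite /rising fact_prod big_add1 big_mkord. Qed.

(** Rising factorials are eigenfunctions of a growth at rate proportional to the
    size: j (f(j+1) - f(j)) = k f(j). *)
Lemma rising_succ k j : (j * rising k j.+1 = rising k j * (j + k))%N.
Proof.
rewrite /rising; transitivity (\prod_(i < k.+1) (j + i))%N.
  rewrite big_ord_recl addn0; congr (_ * _)%N; apply: eq_bigr => i _.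
  by rewrite /= /bump add1n addSnnS.
by rewrite big_ord_recr.
Qed.

Lemma sqr_rising_le k j : (rising k j ^ 2 <= rising (k + k) j)%N.
Proof.
rewrite /rising big_split_ord /= leq_mul //.
by apply: leq_prod => i _; rewrite leq_add2l leq_addl.
Qed.

Section Moments.
Variables (R : realType) (alpha : R).
Hypothesis alpha01 : 0 <= alpha < 1.
Local Notation E := (Eroots alpha).
Implicit Types (s : seq nat) (t m n k b : nat).

Lemma fresh_prob_ge0 t : 0 <= fresh_prob alpha t.
Proof. by case/andP: alpha01 => a0 a1; case: t => [|t] /=; lra. Qed.

Lemma fresh_prob_le1 t : fresh_prob alpha t <= 1.
Proof. by case/andP: alpha01 => a0 a1; case: t => [|t] /=; lra. Qed.

Lemma fresh_probE t : fresh_prob alpha t + alpha / t%:R * t%:R = 1.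
Proof.
case: t => [|t] /=; first by rewrite mulr0 addr0.
by rewrite divfK ?pnatr_eq0 // subrK.
Qed.

Lemma Eroots_linear n c F1 F2 :
  E n (fun s => c * F1 s + F2 s) = c * E n F1 + E n F2.
Proof.
elim: n F1 F2 => //= n IH F1 F2; rewrite -IH; apply: eq_Eroots => s _ _.
by rewrite big_split /= -mulr_sumr; ring.
Qed.

Lemma Eroots_const n c : E n (fun=> c) = c.
Proof.
elim: n => //= n IH; rewrite -[RHS]IH; apply: eq_Eroots => s ss _.
rewrite big_const_seq count_predT ss iter_addr_0 -(mulr_natl c) mulrA -mulrDl.
by rewrite fresh_probE mul1r.
Qed.

Lemma ErootsZ n c F : E n (fun s => c * F s) = c * E n F.
Proof.
have := Eroots_linear n c F (fun=> 0); rewrite Eroots_const addr0 => <-.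
by apply: eq_Eroots => s _ _; rewrite addr0.
Qed.

Lemma ErootsD n F1 F2 : E n (fun s => F1 s + F2 s) = E n F1 + E n F2.
Proof.
have := Eroots_linear n 1 F1 F2; rewrite mul1r => <-.
by apply: eq_Eroots => s _ _; rewrite mul1r.
Qed.

Lemma le_Eroots n F1 F2 :
  (forall s, size s = n -> all (ltn^~ n) s -> F1 s <= F2 s) -> E n F1 <= E n F2.
Proof.
elim: n F1 F2 => [|n IH] F1 F2 H /=; first exact: H.
have wk s x : (x < n.+1)%N -> all (ltn^~ n) s -> all (ltn^~ n.+1) (rcons s x).
  move=> xn sn; rewrite all_rcons /= xn /=.
  by apply: sub_all sn => z /= zn; apply: ltnW.
apply: IH => s ss sn; rewrite lerD ?ler_wpM2l ?fresh_prob_ge0 //.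
- by rewrite H ?size_rcons ?ss ?wk.
- by rewrite divr_ge0 ?ler0n //; case/andP: alpha01.
rewrite big_seq [leRHS]big_seq; apply: ler_sum => x xs.
rewrite H ?size_rcons ?ss ?wk //.
by move/allP: sn => /(_ _ xs) /= xn; apply: ltnW.
Qed.

Lemma Eroots_ge0 n (F : seq nat -> R) : (forall s, 0 <= F s) -> 0 <= E n F.
Proof.
move=> F0; rewrite -[leLHS](Eroots_const n).
by apply: le_Eroots => s _ _.
Qed.

Section Window.
Variables m n : nat.

Definition cluster_moment k s : R :=
  \sum_(m <= b < n) (rising k (count_mem b s))%:R.

Definition cluster_sqr_moment k s : R :=
  \sum_(m <= b < n) (rising k (count_mem b s))%:R ^+ 2.

Definition cluster_offdiag k s : R := cluster_moment k s ^+ 2 - cluster_sqr_moment k s.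

Let jump k s x : R :=
  (rising k (count_mem x s).+1)%:R - (rising k (count_mem x s))%:R.

Lemma count_rcons_mem b s x : count_mem b (rcons s x) = (count_mem b s + (x == b))%N.
Proof. by rewrite -cats1 count_cat /= addn0. Qed.

Lemma sum_window_indic (x : nat) (f : nat -> R) :
  \sum_(m <= b < n) (x == b)%:R * f b = (m <= x < n)%:R * f x.
Proof.
case: (boolP (m <= x < n)%N) => [xmn|xNmn].
  rewrite (bigD1_seq x) ?iota_uniq ?mem_index_iota //= eqxx big1 ?addr0 // => b.
  by rewrite eq_sym => /negbTE ->; rewrite mul0r.
rewrite mul0r big_nat big1 // => b bmn; case: eqP => [xb|]; last by rewrite mul0r.
by rewrite xb bmn in xNmn.
Qed.

Lemma sum_window_count s (f : nat -> R) :
  \sum_(x <- s) (m <= x < n)%:R * f x = \sum_(m <= b < n) (count_mem b s)%:R * f b.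
Proof.
elim: s => [|x s IH].
  by rewrite big_nil big1 // => b _; rewrite mul0r.
rewrite big_cons IH -sum_window_indic -big_split; apply: eq_bigr => b _.
by rewrite /= natrD mulrDl.
Qed.

Lemma cluster_moment_rcons k s x : cluster_moment k (rcons s x) =
  cluster_moment k s + (m <= x < n)%:R * jump k s x.
Proof.
rewrite -sum_window_indic -big_split; apply: eq_bigr => b _.
rewrite count_rcons_mem /jump; case: eqP => [<-|_] /=.
  by rewrite addn1 mul1r addrC subrK.
by rewrite addn0 mul0r addr0.
Qed.

Lemma cluster_sqr_moment_rcons k s x : cluster_sqr_moment k (rcons s x) =
  cluster_sqr_moment k s +
  (m <= x < n)%:R * (jump k s x * (jump k s x + 2 * (rising k (count_mem x s))%:R)).
Proof.
rewrite -(sum_window_indic _ (fun x =>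
  jump k s x * (jump k s x + 2 * (rising k (count_mem x s))%:R))).
rewrite -big_split; apply: eq_bigr => b _.
rewrite count_rcons_mem /jump; case: eqP => [<-|_] /=.
  by rewrite addn1 mul1r; ring.
by rewrite addn0 mul0r addr0.
Qed.

Lemma cluster_offdiag_rcons k s x : cluster_offdiag k (rcons s x) =
  cluster_offdiag k s + (m <= x < n)%:R *
   (2 * jump k s x * (cluster_moment k s - (rising k (count_mem x s))%:R)).
Proof.
rewrite /cluster_offdiag cluster_moment_rcons cluster_sqr_moment_rcons.
by case: (m <= x < n)%N; rewrite ?mul1r ?mul0r; ring.
Qed.

Lemma count_jump k s b :
  (count_mem b s)%:R * jump k s b = k%:R * (rising k (count_mem b s))%:R.
Proof.
have /(congr1 (fun i => i%:R : R)) := rising_succ k (count_mem b s).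
by rewrite /jump !natrM natrD mulrBr => ->; ring.
Qed.

Lemma jump_fresh k s t : (0 < k)%N -> all (ltn^~ t) s ->
  count_mem t s = 0%N /\ jump k s t = k`!%:R.
Proof.
move=> k0 st; have c0 : count_mem t s = 0%N.
  apply/count_memPn/negP => ts; move/allP: st => /(_ _ ts) /=.
  by rewrite ltnn.
by rewrite /jump c0 rising1 rising0 // subr0.
Qed.

(** At size t of the list, an old cluster of size j grows with probability
    alpha j / t, which multiplies its k-th rising factorial by
    1 + alpha k / t on average; a new cluster contributes rising k 1 = k!. *)
Lemma Ecluster_moment_S k t : (0 < k)%N -> E t.+1 (cluster_moment k) =
  (1 + alpha * k%:R / t%:R) * E t (cluster_moment k)
  + fresh_prob alpha t * (m <= t < n)%:R * k`!%:R.
Proof.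
move=> k0 /=; rewrite -[X in _ + X](Eroots_const t) -Eroots_linear.
apply: eq_Eroots => s ss st; have [ct jt] := jump_fresh k0 st.
under eq_bigr do rewrite cluster_moment_rcons.
rewrite big_split /= big_const_seq count_predT ss iter_addr_0 sum_window_count.
under eq_bigr do rewrite count_jump.
rewrite -mulr_sumr -/(cluster_moment k s) cluster_moment_rcons jt.
rewrite -(mulr_natl (cluster_moment k s)).
have := fresh_probE t; set f := fresh_prob _ _ => fE.
have -> : f = 1 - alpha / t%:R * t%:R by apply/eqP; rewrite eq_sym subr_eq fE.
by ring.
Qed.

(** Two distinct clusters never grow at the same step, so products over pairs
    also satisfy a closed recursion, with growth factor 1 + 2 alpha k / t. *)
Lemma Ecluster_offdiag_S k t : (0 < k)%N -> E t.+1 (cluster_offdiag k) =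
  (1 + 2 * (alpha * k%:R / t%:R)) * E t (cluster_offdiag k)
  + 2 * (fresh_prob alpha t * (m <= t < n)%:R * k`!%:R) * E t (cluster_moment k).
Proof.
move=> k0 /=; rewrite -[X in _ + X]ErootsZ -Eroots_linear.
apply: eq_Eroots => s ss st; have [ct jt] := jump_fresh k0 st.
under eq_bigr do rewrite cluster_offdiag_rcons.
rewrite big_split /= big_const_seq count_predT ss iter_addr_0.
rewrite (sum_window_count s (fun x => 2 * jump k s x *
  (cluster_moment k s - (rising k (count_mem x s))%:R))).
have -> : \sum_(m <= b < n) (count_mem b s)%:R * (2 * jump k s b *
   (cluster_moment k s - (rising k (count_mem b s))%:R)) =
   2 * k%:R * cluster_offdiag k s.
  have -> : cluster_offdiag k s = \sum_(m <= b < n) (cluster_moment k s *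
      (rising k (count_mem b s))%:R - (rising k (count_mem b s))%:R ^+ 2).
    by rewrite sumrB -mulr_sumr.
  rewrite mulr_sumr.
  apply: eq_bigr => b _.
  transitivity (2 * ((count_mem b s)%:R * jump k s b) *
                (cluster_moment k s - (rising k (count_mem b s))%:R)); first by ring.
  by rewrite count_jump; ring.
rewrite cluster_offdiag_rcons jt ct rising0 // -(mulr_natl (cluster_offdiag k s)).
have := fresh_probE t; set f := fresh_prob _ _ => fE.
set u := alpha / t%:R in fE *; have -> : alpha * k%:R / t%:R = u * k%:R by rewrite mulrAC.
have -> : f = 1 - u * t%:R by apply/eqP; rewrite eq_sym subr_eq fE.
by ring.
Qed.

Lemma Ecluster_moment_ge0 k t : 0 <= E t (cluster_moment k).
Proof.
apply: Eroots_ge0 => s.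
by apply: sumr_ge0 => b _; rewrite ler0n.
Qed.

(** Negative correlation of distinct clusters: 1 + 2 a is at most (1 + a)^2. *)
Lemma Ecluster_offdiag_le k t : (0 < k)%N ->
  E t (cluster_offdiag k) <= E t (cluster_moment k) ^+ 2.
Proof.
move=> k0; elim: t => [|t IH].
  rewrite /= /cluster_offdiag /cluster_moment /cluster_sqr_moment.
  by rewrite lerBlDr lerDl sumr_ge0 // => b _; rewrite sqr_ge0.
rewrite Ecluster_offdiag_S // Ecluster_moment_S //.
set a := alpha * _ / _; set f := fresh_prob _ _ * _ * _.
have a0 : 0 <= a by rewrite !mulr_ge0 ?invr_ge0 ?ler0n //; case/andP: alpha01.
have f0 : 0 <= f by rewrite !mulr_ge0 ?ler0n ?fresh_prob_ge0.
have M0 := Ecluster_moment_ge0 k t.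
move: (E t (cluster_moment k)) (E t (cluster_offdiag k)) M0 IH => M O M0 OM.
have h1 : (1 + 2 * a) * O <= (1 + 2 * a) * M ^+ 2 by rewrite ler_wpM2l //; lra.
have h2 : 0 <= a * f * M := mulr_ge0 (mulr_ge0 a0 f0) M0.
have h3 : 0 <= (a * M) ^+ 2 by rewrite sqr_ge0.
have h4 : 0 <= f ^+ 2 by rewrite sqr_ge0.
have -> : ((1 + a) * M + f) ^+ 2 =
  (1 + 2 * a) * M ^+ 2 + 2 * f * M + (a * M) ^+ 2 + 2 * (a * f * M) + f ^+ 2 by ring.
lra.
Qed.

(** By negative correlation the variance is at most the diagonal part, and the
    square of a k-th rising factorial is at most the (2k)-th one. *)
Lemma Ecluster_moment_var k t : (0 < k)%N ->
  E t (fun s => (cluster_moment k s - E t (cluster_moment k)) ^+ 2)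
  <= E t (cluster_moment (k + k)).
Proof.
move=> k0; set c := E t (cluster_moment k).
have -> : E t (fun s => (cluster_moment k s - c) ^+ 2) =
    E t (cluster_offdiag k) + E t (cluster_sqr_moment k) - c ^+ 2.
  rewrite -ErootsD -[X in _ + X](Eroots_const t).
  transitivity (E t (fun s => (- (2 * c)) * cluster_moment k s +
      (cluster_offdiag k s + cluster_sqr_moment k s + c ^+ 2))).
    by apply: eq_Eroots => s _ _; rewrite /cluster_offdiag; ring.
  by rewrite Eroots_linear -/c !ErootsD !Eroots_const; ring.
apply: (@le_trans _ _ (E t (cluster_sqr_moment k))).
  have := Ecluster_offdiag_le t k0; rewrite -/c; lra.
apply: le_Eroots => s _ _; apply: ler_sum => b _.
by rewrite -natrX ler_nat sqr_rising_le.
Qed.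

End Window.

Definition growth k b n : R := \prod_(b.+1 <= t < n) (1 + alpha * k%:R / t%:R).

Lemma Ecluster_momentE m n k t : (0 < k)%N -> (t <= n)%N ->
  E t (cluster_moment m n k) =
  k`!%:R * \sum_(m <= b < t) fresh_prob alpha b * growth k b t.
Proof.
move=> k0; elim: t => [|t IH] tn.
  rewrite /= /cluster_moment big1 => [|b _]; last by rewrite rising0.
  by rewrite big_geq // mulr0.
rewrite Ecluster_moment_S // IH ?(ltnW tn) // tn andbT.
case: (leqP m t) => mt; last first.
  by rewrite !big_geq // ?(ltnW mt) // !mulr0 !mul0r addr0.
rewrite mulr1 big_nat_recr //= mulrDr [X in _ + X]mulrC; congr (_ + _).
  rewrite mulrCA; congr (_ * _); rewrite mulr_sumr.
  apply: eq_big_nat => b /andP[_ bt]; rewrite /growth big_nat_recr //=.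
  by rewrite mulrCA [X in _ * X]mulrC.
by rewrite /growth big_geq // mulr1.
Qed.

Definition window_mean m n k : R :=
  k`!%:R * \sum_(m <= b < n) fresh_prob alpha b * growth k b n.

(** Let F be the combination of moments that bounds the sum of the
    sin^2(theta N_b) from below. Where F is at least mu / 2, the product of the
    cos^2 is at most exp(-mu / 2), hence at most 2 / mu; elsewhere it is at
    most 1, and F deviates from its mean by at least mu / 2, so that
    Chebyshev's inequality applies. Both cases are merged in one pointwise
    bound by a quadratic polynomial in the moments. *)
Lemma char_fun_moment_bound (theta a b mu V : R) (m n k l : nat) :
  (0 < k)%N -> (0 < l)%N -> 0 < mu ->
  (forall j, a * (rising k j)%:R - b * (rising l j)%:R <= sin (theta * j%:R) ^+ 2) ->
  mu <= a * window_mean m n k - b * window_mean m n l ->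
  2 * a ^+ 2 * window_mean m n (k + k) + 2 * b ^+ 2 * window_mean m n (l + l) <= V ->
  E n (fun s => \prod_(b < n) cos (theta * (count_mem (b : nat) s)%:R) ^+ 2)
  <= 4 * V / mu ^+ 2 + 2 / mu.
Proof.
move=> k0 l0 mu0 Hsin Hmu HV.
pose ek := E n (cluster_moment m n k); pose el := E n (cluster_moment m n l).
have ekE : ek = window_mean m n k by rewrite /ek Ecluster_momentE.
have elE : el = window_mean m n l by rewrite /el Ecluster_momentE.
(* Q bounds the squared deviation of F, without mixed terms. *)
pose Q s := 2 * a ^+ 2 * (cluster_moment m n k s - ek) ^+ 2
          + 2 * b ^+ 2 * (cluster_moment m n l s - el) ^+ 2.
apply: (@le_trans _ _ (E n (fun s => 4 / mu ^+ 2 * Q s + 2 / mu))); last first.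
  rewrite Eroots_linear Eroots_const lerD2r -mulrA [V / _]mulrC mulrA.
  apply: ler_wpM2l; first by rewrite divr_ge0 ?sqr_ge0.
  apply: le_trans HV; rewrite /Q Eroots_linear ErootsZ.
  have hk := Ecluster_moment_var m n n k0; have hl := Ecluster_moment_var m n n l0.
  rewrite -/ek (@Ecluster_momentE _ _ (k + k)) ?addn_gt0 ?k0 // in hk.
  rewrite -/el (@Ecluster_momentE _ _ (l + l)) ?addn_gt0 ?l0 // in hl.
  by rewrite lerD // ler_wpM2l // mulr_ge0 ?sqr_ge0.
apply: le_Eroots => s ss sn.
set Z := \prod_(b < n) _.
have Z1 : Z <= 1.
  apply: prodr_ile1 => i _; rewrite sqr_ge0 /=.
  by rewrite -[leRHS](cos2Dsin2 (theta * (count_mem (i : nat) s)%:R)) lerDl sqr_ge0.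
pose F := a * cluster_moment m n k s - b * cluster_moment m n l s.
have ZF : Z <= expR (- F).
  rewrite /Z -(big_mkord xpredT (fun b => cos (theta * (count_mem b s)%:R) ^+ 2)).
  have -> : - F = \sum_(m <= i < n) - (a * (rising k (count_mem i s))%:R
                                 - b * (rising l (count_mem i s))%:R).
    by rewrite sumrN sumrB -!mulr_sumr.
  rewrite expR_sum.
  have H1 i : cos (theta * (count_mem i s)%:R) ^+ 2 <=
     expR (- (a * (rising k (count_mem i s))%:R - b * (rising l (count_mem i s))%:R)).
    apply: le_trans (expR_ge1Dx _); rewrite cos2sin2 lerD2l lerN2; exact: Hsin.
  case: (leqP m n) => mn; last first.
    rewrite [leRHS]big_geq ?(ltnW mn) // prodr_ile1 // => i _; rewrite sqr_ge0 /=.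
    by rewrite -[leRHS](cos2Dsin2 (theta * (count_mem (i : nat) s)%:R)) lerDl sqr_ge0.
  rewrite (@big_cat_nat _ _ _ m) //=.
  rewrite -[leRHS]mul1r; apply: ler_pM.
  - by apply: prodr_ge0 => i _; rewrite sqr_ge0.
  - by apply: prodr_ge0 => i _; rewrite sqr_ge0.
  - apply: prodr_ile1 => i _; rewrite sqr_ge0 /=.
    by rewrite -[leRHS](cos2Dsin2 (theta * (count_mem (i : nat) s)%:R)) lerDl sqr_ge0.
  - by apply: ler_prod => i _; rewrite sqr_ge0 H1.
have Q0 : 0 <= Q s.
  by rewrite /Q; apply: addr_ge0; apply: mulr_ge0; rewrite ?sqr_ge0 // mulr_ge0 ?sqr_ge0.
have m2 : 0 < mu ^+ 2 by rewrite exprn_gt0.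
case: (leP (mu / 2) F) => FF.
  apply: (@le_trans _ _ (2 / mu)); last by rewrite lerDr mulr_ge0 // divr_ge0 // ltW.
  apply: (le_trans ZF); rewrite expRN -[2 / mu]invf_div lef_pV2 ?posrE ?expR_gt0 ?divr_gt0 //.
  apply: le_trans (expR_ge1Dx _); apply: (le_trans FF); by rewrite lerDr.
apply: (le_trans Z1); apply: (@le_trans _ _ (4 / mu ^+ 2 * Q s)); last first.
  by rewrite lerDl divr_ge0 // ltW.
rewrite mulrAC ler_pdivlMr // mul1r.
have QF : (F - (a * ek - b * el)) ^+ 2 <= Q s.
  rewrite /F /Q; set x := cluster_moment _ _ _ _ ; set y := cluster_moment _ _ _ _.
  have -> : a * x - b * y - (a * ek - b * el) = a * (x - ek) - b * (y - el) by ring.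
  have -> : 2 * a ^+ 2 * (x - ek) ^+ 2 + 2 * b ^+ 2 * (y - el) ^+ 2 =
            2 * (a * (x - ek)) ^+ 2 + 2 * (b * (y - el)) ^+ 2 by ring.
  move: (a * _) (b * _) => p q; rewrite -subr_ge0.
  have -> : 2 * p ^+ 2 + 2 * q ^+ 2 - (p - q) ^+ 2 = (p + q) ^+ 2 by ring.
  exact: sqr_ge0.
apply: (@le_trans _ _ (4 * (F - (a * ek - b * el)) ^+ 2)); last by rewrite ler_pM2l.
rewrite -ekE -elE in Hmu; move: (a * ek - b * el) Hmu => c Hmu; nra.
Qed.

End Moments.

(** * Fourier analysis on the cyclic group *)

Section Trigo.
Variable R : realType.
Implicit Types x : R.

Lemma cosDpi_nat x n : cos (x + pi * n%:R) = (-1) ^+ n * cos x.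
Proof. by rewrite mulr_natr (alternatingn (@cosDpi R)). Qed.

Lemma sinDpi_nat x n : sin (x + pi * n%:R) = (-1) ^+ n * sin x.
Proof. by rewrite mulr_natr (alternatingn (@sinDpi R)). Qed.

Lemma cosD2pi_nat x n : cos (x + 2 * pi * n%:R) = cos x.
Proof.
rewrite (_ : 2 * pi * _ = pi * (n.*2)%:R); last by rewrite -muln2 natrM; ring.
by rewrite cosDpi_nat -muln2 mulnC exprM sqrrN expr1n expr1n mul1r.
Qed.

Lemma sinD2pi_nat x n : sin (x + 2 * pi * n%:R) = sin x.
Proof.
rewrite (_ : 2 * pi * _ = pi * (n.*2)%:R); last by rewrite -muln2 natrM; ring.
by rewrite sinDpi_nat -muln2 mulnC exprM sqrrN expr1n expr1n mul1r.
Qed.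

Lemma sin_pi_frac_neq0 (L d : nat) : (0 < L)%N -> ~~ (L %| d)%N ->
  sin (pi * d%:R / L%:R : R) != 0.
Proof.
move=> L0 Ld; have LR : L%:R != 0 :> R by rewrite pnatr_eq0 -lt0n.
have -> : pi * d%:R / L%:R = pi * (d %% L)%N%:R / L%:R + pi * (d %/ L)%N%:R :> R.
  by rewrite {1}(divn_eq d L) natrD natrM; field.
rewrite sinDpi_nat mulf_neq0 ?signr_eq0 // gt_eqF //; apply: sin_gt0_pi.
have r0 : 0 < (d %% L)%N%:R :> R by rewrite ltr0n lt0n.
have rL : (d %% L)%N%:R < L%:R :> R by rewrite ltr_nat ltn_mod.
have Lp : 0 < L%:R :> R by rewrite ltr0n.
rewrite divr_gt0 ?mulr_gt0 ?pi_gt0 //= ltr_pdivrMr // ltr_pM2l ?pi_gt0 //.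
Qed.

(** Multiplied by 2 sin(pi d / L), the sum telescopes. *)
Lemma sum_cos_period (L d : nat) : (0 < L)%N -> ~~ (L %| d)%N ->
  \sum_(k < L) cos (2 * pi * (k * d)%:R / L%:R) = 0 :> R.
Proof.
move=> L0 Ld; have LR : L%:R != 0 :> R by rewrite pnatr_eq0 -lt0n.
set u : R := pi * d%:R / L%:R; have su : sin u != 0 by apply: sin_pi_frac_neq0.
apply: (mulfI (mulf_neq0 (_ : 2 != 0) su)); rewrite ?mulr0 // mulr_sumr.
transitivity (\sum_(k < L) (sin (u *+ 2 *+ k.+1 - u) - sin (u *+ 2 *+ k - u))).
  apply: eq_bigr => k _.
  have -> : 2 * pi * (k * d)%:R / L%:R = u *+ 2 *+ k.
    by rewrite -(mulr_natr (u *+ 2)) -(mulr_natr u) /u natrM; ring.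
  rewrite (mulrS (u *+ 2)) (_ : u *+ 2 + _ - u = u *+ 2 *+ k + u); last by ring.
  by rewrite sinD sinB; ring.
rewrite -(big_mkord xpredT (fun k => sin (u *+ 2 *+ k.+1 - u) - sin (u *+ 2 *+ k - u))).
rewrite telescope_sumr // mulr0n sub0r.
have -> : u *+ 2 *+ L - u = - u + 2 * pi * d%:R.
  by rewrite -(mulr_natr (u *+ 2)) -(mulr_natr u) /u; field.
by rewrite sinD2pi_nat subrr.
Qed.

End Trigo.

Section Characters.
Variables (R : realType) (l : nat).
Local Notation L := l.+2.
Implicit Types (g x z : 'Z_L) (k N : nat).

Definition angle (k : nat) : R := 2 * pi * k%:R / L%:R.
Definition chi_re k g : R := cos (angle k * (g : nat)%:R).
Definition chi_im k g : R := sin (angle k * (g : nat)%:R).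

Let LR : L%:R != 0 :> R. Proof. by rewrite pnatr_eq0. Qed.

Lemma angle_mod k N : angle k * N%:R =
  angle k * (N %% L)%N%:R + 2 * pi * (k * (N %/ L))%:R.
Proof. by rewrite {1}(divn_eq N L) natrD !natrM /angle; field. Qed.

Lemma chi_reD k g x : chi_re k (g + x) = chi_re k g * chi_re k x - chi_im k g * chi_im k x.
Proof.
rewrite /chi_re /chi_im -cosD -mulrDr -natrD [in RHS]angle_mod cosD2pi_nat //.
Qed.

Lemma chi_imD k g x : chi_im k (g + x) = chi_im k g * chi_re k x + chi_re k g * chi_im k x.
Proof.
by rewrite /chi_re /chi_im -sinD -mulrDr -natrD [in RHS]angle_mod sinD2pi_nat.
Qed.

Lemma chi_re0 k : chi_re k 0 = 1. Proof. by rewrite /chi_re mulr0 cos0. Qed.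
Lemma chi_im0 k : chi_im k 0 = 0. Proof. by rewrite /chi_im mulr0 sin0. Qed.

Lemma chi_reN k g : chi_re k (- g) = chi_re k g.
Proof.
have e : angle k * (L - g)%N%:R = - (angle k * (g : nat)%:R) + 2 * pi * k%:R.
  rewrite natrB; last exact: ltnW (ltn_ord g).
  by rewrite /angle; field.
rewrite /chi_re -[RHS]cosN -[RHS](cosD2pi_nat _ k) -e [in RHS]angle_mod cosD2pi_nat //.
Qed.

Lemma chi_imN k g : chi_im k (- g) = - chi_im k g.
Proof.
have e : angle k * (L - g)%N%:R = - (angle k * (g : nat)%:R) + 2 * pi * k%:R.
  rewrite natrB; last exact: ltnW (ltn_ord g).
  by rewrite /angle; field.
by rewrite /chi_im -sinN -[RHS](sinD2pi_nat _ k) -e [in RHS]angle_mod sinD2pi_nat.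
Qed.

Lemma chi_re1 k N : chi_re k (1 *+ N) = cos (angle k * N%:R).
Proof. by rewrite /chi_re Zp_nat /= [in RHS]angle_mod cosD2pi_nat. Qed.

Lemma pm1_step_sum (f : 'Z_L -> R) :
  \sum_g @pm1_step R L g * f g = (f 1 + f (-1)) / 2.
Proof.
have S1 (a : 'Z_L) : \sum_g (g == a)%:R * f g / 2 = f a / 2.
  rewrite (bigD1 a) //= eqxx mul1r big1 => [|g /negbTE ->]; first exact: addr0.
  by rewrite !mul0r.
rewrite mulrDl -S1 -[in RHS]S1 -big_split; apply: eq_bigr => g _.
by rewrite /pm1_step /=; field.
Qed.

Lemma pm1_step_chi_re k z N : \sum_g @pm1_step R L g * chi_re k (z + g *+ N) =
  chi_re k z * cos (angle k * N%:R).
Proof.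
rewrite (pm1_step_sum (fun g => chi_re k (z + g *+ N))) mulNrn !chi_reD chi_reN chi_imN chi_re1.
by field.
Qed.

Lemma pm1_step_chi_im k z N : \sum_g @pm1_step R L g * chi_im k (z + g *+ N) =
  chi_im k z * cos (angle k * N%:R).
Proof.
rewrite (pm1_step_sum (fun g => chi_im k (z + g *+ N))) mulNrn !chi_imD chi_reN chi_imN chi_re1.
by field.
Qed.

Lemma eq_Efresh_size n (F1 F2 : seq 'Z_L -> R) :
  (forall y, size y = n -> F1 y = F2 y) ->
  Efresh (@pm1_step R L) n F1 = Efresh (@pm1_step R L) n F2.
Proof.
elim: n F1 F2 => [|n IH] F1 F2 H /=; first exact: H.
apply: IH => y sy; apply: eq_bigr => g _; rewrite H // size_rcons sy //.
Qed.

(** A function on which every step law N Y acts by multiplication, as the real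
    and imaginary parts of a character under symmetric steps, is multiplied by
    the product over the clusters. *)
Lemma Efresh_multiplier (f : 'Z_L -> R) (c : nat -> R) (x : 'Z_L) n (N : nat -> nat) :
  (forall z m, \sum_g @pm1_step R L g * f (z + g *+ m) = f z * c m) ->
  Efresh (@pm1_step R L) n (fun y => f (x + \sum_(b < n) nth 0 y b *+ N b)) =
  f x * \prod_(b < n) c (N b).
Proof.
move=> fc; elim: n => [|n IH] /=; first by rewrite !big_ord0 mulr1 addr0.
rewrite big_ord_recr /= mulrA -IH [RHS]mulrC -EfreshZ.
apply: eq_Efresh_size => y sy; rewrite mulrC -fc; apply: eq_bigr => g _.
congr (_ * f _); rewrite big_ord_recr /= -addrA; congr (_ + (_ + _)).
  by apply: eq_bigr => b _; rewrite nth_rcons sy ltn_ord.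
by rewrite nth_rcons sy ltnn eqxx.
Qed.

Lemma sum_count (f : nat -> 'Z_L) n s : all (ltn^~ n) s ->
  \sum_(r <- s) f r = \sum_(b < n) f b *+ count_mem (b : nat) s.
Proof.
elim: s => [_|r s IH /= /andP[rn sn]].
  by rewrite big_nil big1.
rewrite big_cons IH //; under [RHS]eq_bigr do rewrite mulrnDr.
rewrite big_split /=; congr (_ + _).
rewrite (bigD1 (Ordinal rn)) //= eqxx big1 ?addr0 // => b.
by rewrite -val_eqE /= eq_sym => /negbTE ->.
Qed.

Variables (alpha : R) (W : cyclic_srrw L alpha).

Lemma srrw_multiplier n (f : 'Z_L -> R) (c : nat -> R) : (0 < n)%N ->
  (forall z m, \sum_g @pm1_step R L g * f (z + g *+ m) = f z * c m) ->
  \sum_g srrw_law W n g * f g =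
  f 0 * Eroots alpha n (fun s => \prod_(b < n) c (count_mem (b : nat) s)).
Proof.
move=> n0 fc; rewrite srrw_expectation //.
transitivity (Eroots alpha n (fun s => f 0 * \prod_(b < n) c (count_mem (b : nat) s))).
  apply: eq_Eroots => s ss sn.
  rewrite -(Efresh_multiplier 0 n (fun b => count_mem b s) fc).
  apply: eq_Efresh_size => y sy; congr f; rewrite add0r.
  exact: (sum_count (nth 0 y) sn).
by rewrite ErootsZ.
Qed.

Lemma srrw_law_ge0 n g : 0 <= srrw_law W n g.
Proof. by rewrite /srrw_law fine_ge0. Qed.

Lemma sum_srrw_law n : (0 < n)%N -> \sum_g srrw_law W n g = 1.
Proof.
move=> n0; transitivity (\sum_g srrw_law W n g * 1).
  by apply: eq_bigr => g _; rewrite mulr1.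
rewrite (@srrw_multiplier n (fun=> 1) (fun=> 1)) // ?mul1r; last first.
  by move=> z m; rewrite (pm1_step_sum (fun=> 1)); field.
rewrite -[RHS](Eroots_const alpha n); apply: eq_Eroots => s _ _.
by rewrite prodr_const expr1n.
Qed.

(** The Fourier coefficient of the law of the walk; it is real because the steps
    are symmetric (srrw_chi_im). *)
Definition char_fun (n k : nat) : R :=
  Eroots alpha n (fun s => \prod_(b < n) cos (angle k * (count_mem (b : nat) s)%:R)).

Lemma srrw_chi_re n k : (0 < n)%N -> \sum_g srrw_law W n g * chi_re k g = char_fun n k.
Proof.
move=> n0; rewrite (srrw_multiplier n0 (pm1_step_chi_re k)) chi_re0 mul1r //.
Qed.

Lemma srrw_chi_im n k : (0 < n)%N -> \sum_g srrw_law W n g * chi_im k g = 0.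
Proof.
by move=> n0; rewrite (srrw_multiplier n0 (pm1_step_chi_im k)) chi_im0 mul0r.
Qed.

(** The frequencies are the multiples of a fixed h prime to L: any such
    listing runs over all characters. *)
Lemma chi_orthogonal h g x : coprime L h ->
  \sum_(k < L) (chi_re (k * h) g * chi_re (k * h) x + chi_im (k * h) g * chi_im (k * h) x)
  = L%:R * (g == x)%:R.
Proof.
move=> Lh; wlog gx : g x / (x <= g)%N => [H|].
  case/orP: (leq_total x g) => [|xg]; first exact: H.
  rewrite eq_sym -(H x g) //; apply: eq_bigr => k _.
  by rewrite mulrC [chi_im _ g * _]mulrC.
transitivity (\sum_(k < L) cos (2 * pi * (k * (h * (g - x)))%:R / L%:R : R)).
  apply: eq_bigr => k _; rewrite /chi_re /chi_im -cosB; congr cos.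
  by rewrite !natrM natrB // /angle natrM; field.
case: eqVneq => [->|gNx].
  under eq_bigr do rewrite subnn !muln0 mulr0 mul0r cos0.
  by rewrite mulr1 sumr_const card_ord.
rewrite sum_cos_period ?mulr0 // Gauss_dvdr //.
have g0 : (0 < g - x)%N by rewrite subn_gt0 ltn_neqAle gx andbT eq_sym.
by rewrite gtnNdvd // (leq_ltn_trans (leq_subr _ _)) // ltn_ord.
Qed.

Lemma plancherel h (p : 'Z_L -> R) : coprime L h ->
  L%:R * \sum_g p g ^+ 2 =
  \sum_(k < L) ((\sum_g p g * chi_re (k * h) g) ^+ 2
                 + (\sum_g p g * chi_im (k * h) g) ^+ 2).
Proof.
move=> Lh; under [RHS]eq_bigr do rewrite !expr2 !big_distrlr /= -big_split /=.
rewrite [RHS]exchange_big /= mulr_sumr; apply: eq_bigr => g _.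
under [RHS]eq_bigr do rewrite -big_split /=.
rewrite [RHS]exchange_big /= (bigD1 g) //= [X in _ + X]big1 => [|x xg]; last first.
  transitivity (p g * p x * (L%:R * (g == x)%:R)); last first.
    by rewrite eq_sym (negbTE xg) !mulr0.
  rewrite -(chi_orthogonal _ _ Lh) mulr_sumr; apply: eq_bigr => k _; ring.
rewrite addr0.
transitivity (p g * p g * (L%:R * (g == g)%:R)); first by rewrite eqxx mulr1; ring.
by rewrite -(chi_orthogonal _ _ Lh) mulr_sumr; apply: eq_bigr => k _; ring.
Qed.

(** Squared L2-distance, relative to the uniform measure, between the density of
    the law of the walk and 1. *)
Definition chi2 (n : nat) : R := L%:R * \sum_g srrw_law W n g ^+ 2 - 1.

(** The frequency 0 contributes the total mass 1, which is subtracted. *)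
Lemma chi2E n h : (0 < n)%N -> coprime L h ->
  chi2 n = \sum_(1 <= k < L) char_fun n (k * h) ^+ 2.
Proof.
move=> n0 Lh; rewrite /chi2 (plancherel _ Lh) big_ord_recl /= mul0n.
rewrite srrw_chi_im // srrw_chi_re //.
have -> : char_fun n 0 = 1.
  rewrite -srrw_chi_re // -[RHS](sum_srrw_law n0); apply: eq_bigr => g _.
  by rewrite /chi_re /angle mulr0 !mul0r cos0 mulr1.
rewrite expr1n expr0n addr0 addrAC subrr add0r big_add1 /= big_mkord.
by apply: eq_bigr => k _; rewrite srrw_chi_im // srrw_chi_re // expr0n addr0.
Qed.

End Characters.

(** * Growth factors and power sums *)

Lemma eq_lerW (R : numDomainType) (x y : R) : x = y -> x <= y.
Proof. by move->. Qed.

Section PowerSums.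
Variable R : realType.

(** A discrete substitute for the derivative of x^(-q), which makes the
    sum of the j^(-q-1) telescope: exp(1 / (j + 1)) is at most (j + 1) / j. *)
Lemma powR_sub_le (q : R) (j : nat) : 0 <= q -> (0 < j)%N ->
  j.+1%:R `^ (- q) * (1 + q / j.+1%:R) <= j%:R `^ (- q).
Proof.
move=> q0 j0; have jp : 0 < j%:R :> R by rewrite ltr0n.
have j1p : 0 < j.+1%:R :> R by rewrite ltr0n.
apply: (@le_trans _ _ (j.+1%:R `^ (- q) * (expR (j.+1%:R^-1) `^ q))).
  rewrite ler_wpM2l ?powR_ge0 // -expRM mulrC; exact: expR_ge1Dx.
have H : expR (j.+1%:R^-1) <= j.+1%:R / j%:R :> R.
  rewrite -[leLHS]invrK -expRN -[leRHS]invrK lef_pV2 ?posrE ?invr_gt0 ?divr_gt0 ?expR_gt0 //.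
  rewrite invf_div; apply: le_trans (expR_ge1Dx _).
  by rewrite -[j.+1]addn1 natrD -subr_ge0; apply/eq_lerW; field; rewrite natr1 pnatr_eq0.
apply: (@le_trans _ _ (j.+1%:R `^ (- q) * (j.+1%:R / j%:R) `^ q)).
  rewrite ler_wpM2l ?powR_ge0 //; apply: ge0_ler_powR => //.
  - by rewrite nnegrE expR_ge0.
  - by rewrite nnegrE divr_ge0.
rewrite powRM ?invr_ge0 // mulrA -powRD; last by rewrite pnatr_eq0 implybT.
by rewrite addNr powRr0 mul1r -powR_inv1 // -powRrM mulN1r.
Qed.

Lemma sum_powR_le (p : R) N : 1 < p ->
  \sum_(1 <= j < N) (j%:R `^ (- p) : R) <= p / (p - 1).
Proof.
move=> p1; set q := p - 1; have q0 : 0 < q by rewrite subr_gt0.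
suff H n : \sum_(1 <= j < n.+2) (j%:R `^ (- p) : R) + n.+1%:R `^ (- q) / q <= p / q.
  case: N => [|[|n]]; try by rewrite big_geq // divr_ge0 // ?ltW // (lt_trans ltr01).
  by apply: le_trans (H n); rewrite lerDl divr_ge0 ?powR_ge0 ?ltW.
elim: n => [|n IH].
  rewrite big_nat1 !powR1; apply/eq_lerW; rewrite /q; field; by rewrite -/q gt_eqF.
rewrite big_nat_recr //=; apply: le_trans IH; rewrite -addrA lerD2l.
have := powR_sub_le (ltW q0) (ltn0Sn n).
have -> : n.+2%:R `^ (- p) = n.+2%:R `^ (- q) / n.+2%:R :> R.
  rewrite -powR_inv1 // -powRD; last by rewrite pnatr_eq0 /= implybT.
  by congr powR; rewrite /q; ring.
rewrite -(ler_pM2r (x := q^-1)) ?invr_gt0 // => {}IH.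
apply: le_trans IH; apply: eq_lerW; field.
by rewrite gt_eqF //= nat1r pnatr_eq0.
Qed.

Lemma ln_ratio_bounds (x y : R) : 0 < x -> x <= y -> (y - x) / y <= ln y - ln x.
Proof.
move=> x0 xy; have y0 := lt_le_trans x0 xy.
rewrite -[leRHS]opprB -[leLHS]opprK lerN2 -ln_div ?posrE //.
have -> : x / y = 1 + - ((y - x) / y) by field; rewrite gt_eqF.
by apply: le_ln1Dx; rewrite ltrN2 ltr_pdivrMr // mul1r ltrBlDr ltrDl.
Qed.

Lemma ln_ratio_upper (x y : R) : 0 < x -> x <= y -> ln y - ln x <= (y - x) / x.
Proof.
move=> x0 xy; have y0 := lt_le_trans x0 xy.
rewrite -ln_div ?posrE //.
have -> : y / x = 1 + (y - x) / x by field; rewrite gt_eqF.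
apply: le_ln1Dx; apply: (@lt_le_trans _ _ 0); first by rewrite ltrN10.
by rewrite divr_ge0 ?subr_ge0 // ltW.
Qed.

Lemma sum_inv_le_ln N : (0 < N)%N ->
  \sum_(0 <= b < N) (b.+1%:R^-1 : R) <= 1 + ln N%:R.
Proof.
case: N => // N _; elim: N => [|N IH].
  by rewrite big_nat1 invr1 ln1 addr0.
rewrite big_nat_recr //=; apply: (le_trans (lerD IH (lexx _))).
have := @ln_ratio_bounds N.+1%:R N.+2%:R; rewrite ltr0n ler_nat => /(_ isT (leqnSn _)).
rewrite -natrB // subSnn mul1r; move: (ln N.+2%:R) (ln N.+1%:R) (N.+2%:R^-1) => x y z; lra.
Qed.

Lemma ln_le_sum_inv m n c : (m <= n)%N ->
  ln (n + c.+1)%:R - ln (m + c.+1)%:R <= \sum_(m <= b < n) ((b + c.+1)%:R^-1 : R).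
Proof.
elim: n => [|n IH]; first by rewrite leqn0 => /eqP ->; rewrite subrr big_geq.
rewrite leq_eqVlt => /predU1P[->|mn]; first by rewrite subrr big_geq.
rewrite big_nat_recr //=; apply: le_trans (lerD (IH mn) (lexx _)).
have p0 : 0 < (n + c.+1)%:R :> R by rewrite ltr0n addnS.
have p1 : (n + c.+1)%:R <= (n.+1 + c.+1)%:R :> R by rewrite ler_nat leq_add2r.
have := ln_ratio_upper p0 p1; rewrite -natrB ?leq_add2r // subnDr subSnn mul1r.
move: (ln (n.+1 + c.+1)%:R) (ln (n + c.+1)%:R) (ln (m + c.+1)%:R) (_^-1) => x y z w; lra.
Qed.

End PowerSums.

Section Growth.
Variables (R : realType) (alpha : R).
Hypothesis alpha01 : 0 <= alpha < 1.
Let a0 : 0 <= alpha. Proof. by case/andP: alpha01. Qed.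
Let a1 : alpha < 1. Proof. by case/andP: alpha01. Qed.
Implicit Types (k b n m : nat).

Lemma growth_ge1 k b n : 1 <= growth alpha k b n.
Proof.
rewrite /growth; elim/big_ind: _ => // [x y x1 y1|t _].
  by rewrite -[leLHS]mul1r ler_pM.
by rewrite lerDl !mulr_ge0 ?invr_ge0.
Qed.

Lemma growth_ge0 k b n : 0 <= growth alpha k b n.
Proof. exact: le_trans ler01 (growth_ge1 k b n). Qed.

(** 1 + 2 x is at most (1 + x)^2, factor by factor. *)
Lemma growth_double k b n : growth alpha (k + k) b n <= growth alpha k b n ^+ 2.
Proof.
rewrite /growth -prodrXl; apply: ler_prod => t _; apply/andP; split.
  by rewrite addr_ge0 // !mulr_ge0 ?invr_ge0.
rewrite natrD -subr_ge0.
have -> : (1 + alpha * k%:R / t%:R) ^+ 2 - (1 + alpha * (k%:R + k%:R) / t%:R)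
   = (alpha * k%:R / t%:R) ^+ 2 by ring.
exact: sqr_ge0.
Qed.

Lemma growth1_le b n : (b < n)%N -> growth alpha 1 b n <= n%:R / b.+1%:R.
Proof.
case: n => // n; rewrite ltnS; elim: n => [|n IH].
  by rewrite leqn0 => /eqP ->; rewrite /growth big_geq // divff.
rewrite leq_eqVlt => /predU1P[->|bn]; first by rewrite /growth big_geq // divff.
rewrite /growth big_nat_recr //= -/(growth _ _ _ _).
apply: (@le_trans _ _ (n.+1%:R / b.+1%:R * (n.+2%:R / n.+1%:R))); last first.
  by apply: eq_lerW; field; rewrite !nat1r !pnatr_eq0.
apply: ler_pM; rewrite ?growth_ge0 ?IH //.
  by rewrite addr_ge0 // !mulr_ge0 ?invr_ge0.
rewrite ler_pdivlMr // mulrDl mul1r divfK // mulr1 -[n.+2]addn1 natrD lerD2l ltW //.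
Qed.

(** Each factor 1 + q / t is at most (t / (t - 1))^q, and the bases telescope. *)
Lemma growth_le_powR k b n : (0 < b <= n)%N ->
  growth alpha k b n.+1 <= (n%:R / b%:R) `^ (alpha * k%:R).
Proof.
case/andP => b0; elim: n => [|n IH]; first by rewrite leqNgt b0.
rewrite leq_eqVlt => /predU1P[->|bn].
  by rewrite /growth big_geq // divff // powR1.
have n0 : (0 < n)%N by apply: leq_trans b0 bn.
rewrite /growth big_nat_recr //= -/(growth _ _ _ _).
have q0 : 0 <= alpha * k%:R by rewrite mulr_ge0.
have H : 1 + alpha * k%:R / n.+1%:R <= (n.+1%:R / n%:R) `^ (alpha * k%:R).
  have := powR_sub_le q0 n0; rewrite mulrC !powRN ler_pdivrMr ?powR_gt0 ?ltr0n //.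
  rewrite [leRHS]mulrC => /le_trans; apply.
  by rewrite powRM ?invr_ge0 // -[n%:R^-1]powR_inv1 // -powRrM mulN1r powRN.
apply: (@le_trans _ _ ((n%:R / b%:R) `^ (alpha * k%:R) * (n.+1%:R / n%:R) `^ (alpha * k%:R))).
  by rewrite ler_pM ?growth_ge0 ?IH // addr_ge0 // !mulr_ge0 ?invr_ge0.
rewrite -powRM ?divr_ge0 //; apply: eq_lerW; congr powR; field.
by rewrite !pnatr_eq0 -!lt0n b0 n0.
Qed.

(** With q = 2 alpha at most 2, each factor 1 + q / t is at least
    exp(q / (t + q)), hence at least (1 + 1 / (t + 2))^q; again the bases
    telescope, which explains the shift by 3. *)
Lemma growth2_ge_powR b n : (b <= n)%N ->
  ((n + 3)%:R / (b + 3)%:R) `^ (alpha * 2) <= growth alpha 2 b n.+1.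
Proof.
elim: n => [|n IH].
  by rewrite leqn0 => /eqP ->; rewrite divff // powR1 growth_ge1.
rewrite leq_eqVlt => /predU1P[->|bn]; first by rewrite divff ?addn3 // powR1 growth_ge1.
rewrite /growth big_nat_recr //= -/(growth _ _ _ _).
have q0 : 0 <= alpha * 2 by rewrite mulr_ge0.
have -> : (n.+1 + 3)%:R / (b + 3)%:R = (n + 3)%:R / (b + 3)%:R * ((n.+1 + 3)%:R / (n + 3)%:R) :> R.
  by rewrite [RHS]mulrC mulrA divfK // pnatr_eq0 addn3.
rewrite powRM ?divr_ge0 //; apply: ler_pM; rewrite ?powR_ge0 ?IH //.
set x := alpha * 2 in q0 *; have x2 : x <= 2 by rewrite /x; have := a1; lra.
have -> : (n.+1 + 3)%:R / (n + 3)%:R = 1 + (n + 3)%:R^-1 :> R.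
  by rewrite addSn -[(n + 3).+1]addn1 natrD mulrDl divff ?mul1r // pnatr_eq0 addn3.
apply: (@le_trans _ _ (expR ((n + 3)%:R^-1 * x))).
  by rewrite expRM ge0_ler_powR ?nnegrE ?addr_ge0 ?expR_ge0 ?invr_ge0 ?expR_ge1Dx.
rewrite -[leLHS]invrK -expRN -[leRHS]invrK lef_pV2 ?posrE ?invr_gt0 ?expR_gt0 //; last first.
  by rewrite ltr_wpDr // divr_ge0.
apply: le_trans (expR_ge1Dx _).
have n3 : 0 < (n + 3)%:R :> R by rewrite addn3.
have -> : (1 + x / n.+1%:R)^-1 = 1 - x / (n.+1%:R + x).
  have : 0 < n.+1%:R :> R by []; move: (n.+1%:R) => N N0.
  by field; rewrite !gt_eqF // ltr_wpDr.
rewrite lerD2l lerN2 mulrC ler_wpM2l // lef_pV2 ?posrE //; last by rewrite ltr_wpDr.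
by rewrite (_ : (n + 3)%N = (n.+1 + 2)%N) ?natrD ?lerD2l // addSnnS.
Qed.

Lemma growth_le_ratio k b n : (0 < b < n)%N ->
  growth alpha k b n <= (n%:R / b%:R) `^ (alpha * k%:R).
Proof.
case: n => [|n]; first by rewrite ltn0 andbF.
rewrite ltnS => h; apply: (le_trans (growth_le_powR k h)).
apply: ge0_ler_powR; rewrite ?nnegrE ?divr_ge0 // ?mulr_ge0 //.
by rewrite ler_wpM2r ?invr_ge0 // ler_nat.
Qed.

Lemma growth2_ge_ratio b n : (b < n)%N ->
  (n%:R / (b + 3)%:R) `^ (alpha * 2) <= growth alpha 2 b n.
Proof.
case: n => [|n] //; rewrite ltnS => h; apply: le_trans (growth2_ge_powR h).
apply: ge0_ler_powR; rewrite ?nnegrE ?divr_ge0 // ?mulr_ge0 //.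
by rewrite ler_wpM2r ?invr_ge0 // ler_nat addn3 ltnS leqW.
Qed.

End Growth.

(** * Elementary bounds on sine and cosine *)

Section SineBounds.
Variable R : realType.
Implicit Types x y : R.

Lemma le_of_derive_ge0 (f f' : R -> R) (b : R) : 0 <= b ->
  (forall x, is_derive x 1 f (f' x)) -> (forall x, 0 < x < b -> 0 <= f' x) ->
  f 0 <= f b.
Proof.
move=> b0 df f'0.
have fd x : derivable f x 1 by have [] := df x.
apply: (@ger0_derive1_ndecr R f 0 b) => //.
- move=> x; rewrite in_itv /= => xb.
  by have dx := df x; rewrite derive1E derive_val f'0.
- by apply: continuous_subspaceT => x; apply/differentiable_continuous/derivable1_diffP.
Qed.

Lemma sin_le_id x : 0 <= x -> sin x <= x.
Proof.
move=> x0; rewrite -subr_ge0.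
have H := @le_of_derive_ge0 (fun x => x - sin x) (fun x => 1 - cos x) x x0.
rewrite /= sin0 subr0 in H; apply: H => y _.
by rewrite subr_ge0 cos_le1.
Qed.

Lemma sqr_sin_le x : sin x ^+ 2 <= x ^+ 2.
Proof.
wlog x0 : x / 0 <= x => [H|].
  case: (leP 0 x) => [|xn]; first exact: H.
  by have := H (- x); rewrite sinN !sqrrN oppr_ge0; apply; apply: ltW.
case: (leP x 1) => [x1|x1]; last first.
  rewrite sin2cos2; have := sqr_ge0 (cos x); have : 1 <= x ^+ 2 by rewrite exprn_ege1 // ltW.
  by lra.
rewrite lerXn2r ?nnegrE ?sin_le_id // sin_ge0_pi // x0 /=.
by have := pi_ge2 R; lra.
Qed.

Lemma one_sub_cos_le x : 1 - cos x <= x ^+ 2 / 2.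
Proof.
have := sqr_sin_le (x / 2); rewrite sin2cos2.
have -> : cos x = cos (x / 2) ^+ 2 *+ 2 - 1.
  by rewrite -cos_mulr2n; rewrite mulr2n -splitr.
by move: (cos (x / 2)) => c; rewrite expr_div_n (mulr2n (c ^+ 2)); lra.
Qed.

Lemma mul_cos_le_sin x : 0 <= x <= pi / 2 -> x * cos x <= sin x.
Proof.
move=> /andP[x0 xpi]; rewrite -subr_ge0.
have H := @le_of_derive_ge0 (fun x => sin x - x * cos x) (fun x => x * sin x) x x0.
rewrite /= sin0 mul0r subr0 in H; apply: H => [y|y /andP[y0 yx]].
  have -> : y * sin y = cos y - (y *: (- sin y) + cos y *: 1).
    by rewrite /GRing.scale /=; ring.
  by apply: is_deriveB; apply: is_deriveM.
rewrite mulr_ge0 ?ltW // sin_gt0_pi // y0 /=.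
by have := pi_gt0 R; lra.
Qed.

Lemma half_le_sin x : 0 <= x <= pi / 2 -> x / 2 <= sin x.
Proof.
move=> /andP[x0 xpi]; have pi0 := pi_gt0 R.
have cx : 0 <= cos x by rewrite cos_ge0_pihalf // xpi andbT; lra.
have x2E : x = (x / 2) *+ 2 by rewrite mulr2n -splitr.
have c2 : 1 / 2 <= cos (x / 2) ^+ 2.
  by move: cx; rewrite {1}x2E cos_mulr2n (mulr2n (_ ^+ 2)); lra.
have h : x / 2 * cos (x / 2) <= sin (x / 2) by apply: mul_cos_le_sin; lra.
have ch : 0 <= cos (x / 2) by rewrite cos_ge0_pihalf //; lra.
rewrite {2}x2E sin_mulr2n.
have := ler_wpM2l ch h; move: (cos (x / 2)) (sin (x / 2)) c2 => c s c2; nra.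
Qed.

(** Below pi / 2 this is the square of x cos x <= sin x, since cos^2 x is at
    least 1 - x^2; beyond, the left-hand side is negative. *)
Lemma sqr_sin_ge x : 0 <= x -> x ^+ 2 - x ^+ 4 <= sin x ^+ 2.
Proof.
move=> x0; have := pihalf_ge1 R => p1.
case: (leP x (pi / 2)) => xpi; last first.
  apply: (@le_trans _ _ 0); last exact: sqr_ge0.
  have x1 : 1 <= x ^+ 2 by rewrite exprn_ege1 //; lra.
  by rewrite -[4%N]/(2 + 2)%N exprD; nra.
have xx : 0 <= x <= pi / 2 by rewrite x0.
have h := mul_cos_le_sin xx.
have cx : 0 <= cos x by rewrite cos_ge0_pihalf // xpi andbT; lra.
apply: (@le_trans _ _ ((x * cos x) ^+ 2)); last first.
  by rewrite lerXn2r ?nnegrE ?mulr_ge0 // (le_trans _ h) // mulr_ge0.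
rewrite exprMn cos2sin2 mulrBr mulr1 lerD2l lerN2 -[4%N]/(2 + 2)%N exprD.
by rewrite ler_wpM2l ?sqr_ge0 ?sqr_sin_le.
Qed.

End SineBounds.

(** * Squared characters, frequency by frequency *)

Lemma rising1E j : rising 1 j = j.
Proof. by rewrite /rising big_ord1 addn0. Qed.

Lemma rising2E j : rising 2 j = (j * j.+1)%N.
Proof. by rewrite /rising big_ord_recl big_ord1 addn0 /bump addn1. Qed.

Lemma rising4_ge j : (j ^ 4 <= rising 4 j)%N.
Proof.
rewrite /rising !big_ord_recl big_ord0 /bump /= !muln1 !expnS expn0 muln1.
by rewrite !leq_mul // leq_addr.
Qed.

Lemma fact8_le (R : realType) : (8`!)%:R * (1 / (100 * 100 * 100)) <= 1 / 20 :> R.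
Proof. by rewrite !factS fact0 !natrM; lra. Qed.

(** The window [m, n) is a positive fraction of [0, n), yet short enough for
    the growth factors over it to be close to 1. *)
Lemma last_twentieth n : (20 <= n)%N ->
  exists m, [/\ (0 < m)%N, (m <= n)%N, (n <= 40 * (n - m))%N & (19 * n <= 20 * m)%N].
Proof.
move=> n20; exists (n - n %/ 20)%N.
have : (n < 20 * (n %/ 20).+1)%N by rewrite mulnC ltn_ceil.
have : (20 * (n %/ 20) <= n)%N by rewrite mulnC leq_trunc_div.
move: (n %/ 20)%N => w h1 h2; split; lia.
Qed.

Section SquaredCharacters.
Variables (R : realType) (alpha : R).
Hypothesis alpha01 : 0 <= alpha < 1.
Let a0 : 0 <= alpha. Proof. by case/andP: alpha01. Qed.
Let a1 : 0 < 1 - alpha. Proof. by case/andP: alpha01 => _; rewrite subr_gt0. Qed.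
Implicit Types (theta x : R) (m n : nat).

Definition sqr_char theta n : R :=
  Eroots alpha n (fun s => \prod_(b < n) cos (theta * (count_mem (b : nat) s)%:R) ^+ 2).

Lemma sqr_char_le1 theta n : sqr_char theta n <= 1.
Proof.
rewrite -[leRHS](Eroots_const alpha n); apply: (le_Eroots alpha01) => s _ _.
apply: prodr_ile1 => b _; rewrite sqr_ge0 /=.
by rewrite -[leRHS](cos2Dsin2 (theta * (count_mem (b : nat) s)%:R)) lerDl sqr_ge0.
Qed.

(** Bounds at least 1 being trivial, the others may be assumed less than 1. *)
Lemma sqr_char_le theta n (B : R) : (B < 1 -> sqr_char theta n <= B) -> sqr_char theta n <= B.
Proof.
by move=> H; case: (ltP B 1) => // B1; apply: le_trans B1; apply: sqr_char_le1.
Qed.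

Lemma window_meanE m n k : (0 < m)%N -> window_mean alpha m n k =
  k`!%:R * (1 - alpha) * \sum_(m <= b < n) growth alpha k b n.
Proof.
move=> m0; rewrite /window_mean -mulrA; congr (_ * _); rewrite mulr_sumr.
by apply: eq_big_nat => b /andP[mb _]; case: b mb => //; case: m m0.
Qed.

Lemma growth_sum_ge m n k : (m <= n)%N ->
  (n - m)%:R <= \sum_(m <= b < n) growth alpha k b n.
Proof.
move=> mn; rewrite -[leLHS]mul1r mulr_natr -sumr_const_nat.
by apply: ler_sum => b _; apply: growth_ge1.
Qed.

Lemma growth_sum_le m n k (c : R) :
  (forall b, (m <= b < n)%N -> growth alpha k b n <= c) ->
  \sum_(m <= b < n) growth alpha k b n <= (n - m)%:R * c.
Proof.
move=> H; rewrite mulr_natl -sumr_const_nat.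
by rewrite big_nat [leRHS]big_nat; apply: ler_sum.
Qed.

(** Valid at all frequencies, because only the singletons matter: the bound
    sin^2(theta j) >= sin^2(theta) (3 j - j (j + 1)) is an equality at j = 1 and
    has a nonpositive right-hand side for j >= 2. Clusters born in the last
    twentieth of the time are mostly singletons, so that the mean of the
    right-hand side is still a positive multiple of n. *)
Lemma sqr_char_bound_all theta n : (0 < n)%N -> sin theta != 0 ->
  sqr_char theta n <= (350 * 200) / ((1 - alpha) * n%:R * sin theta ^+ 2).
Proof.
move=> n0 sn0; apply: sqr_char_le => Hlt.
have [S ES] : exists S, S = sin theta ^+ 2 by eexists.
rewrite -ES in Hlt *.
have S0 : 0 < S by rewrite ES exprn_even_gt0.
have S1 : S <= 1 by rewrite ES -(cos2Dsin2 theta) lerDr sqr_ge0.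
have nR : 0 < n%:R :> R by rewrite ltr0n.
have n20 : (20 <= n)%N.
  rewrite leqNgt; apply/negP => n20; move: Hlt; apply/negP; rewrite -leNgt.
  rewrite ler_pdivlMr ?mul1r; last by rewrite !mulr_gt0.
  have nR20 : n%:R <= 20 :> R by rewrite ler_nat ltnW.
  have al1 : 1 - alpha <= 1 by rewrite gerBl.
  have h1 : (1 - alpha) * n%:R <= 1 * 20 by apply: ler_pM => //; exact: ltW.
  have : (1 - alpha) * n%:R * S <= 1 * 20 * 1.
    by apply: ler_pM => //; rewrite ?mulr_ge0 ?ltW.
  by lra.
have [m [m0 mn]] := last_twentieth n20; set w := (n - m)%N => nw n19.
have w0 : (0 < w)%N by rewrite lt0n; apply: contraTneq nw => ->; rewrite -ltnNge.
have g1 b : (m <= b < n)%N -> growth alpha 1 b n <= 20 / 19.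
  move=> /andP[mb bn]; apply: (le_trans (growth1_le alpha01 bn)).
  rewrite ler_pdivrMr // mulrAC ler_pdivlMr // -!natrM ler_nat mulnC.
  by apply: (leq_trans n19); rewrite leq_mul2l leqW.
have g2 b : (m <= b < n)%N -> growth alpha 2 b n <= (20 / 19) ^+ 2.
  move=> mb; apply: (le_trans (growth_double alpha01 1 b n)).
  by rewrite lerXn2r ?nnegrE ?growth_ge0 ?g1 // divr_ge0.
have g4 b : (m <= b < n)%N -> growth alpha 4 b n <= ((20 / 19) ^+ 2) ^+ 2.
  move=> mb; apply: (le_trans (growth_double alpha01 2 b n)).
  by rewrite lerXn2r ?nnegrE ?growth_ge0 ?g2 // sqr_ge0.
have G1 := growth_sum_ge 1 mn; have G2 := growth_sum_le g2; have G4 := growth_sum_le g4.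
rewrite -/w in G1 G2 G4.
have wR : 0 < w%:R :> R by rewrite ltr0n.
set T := (1 - alpha) * w%:R; have T0 : 0 < T by rewrite mulr_gt0.
have M1 : T <= window_mean alpha m n 1.
  by rewrite window_meanE // (_ : (1`!)%:R = 1 :> R) // mul1r ler_pM2l.
have M2 : window_mean alpha m n 2 <= 2 * T * (20 / 19) ^+ 2.
  rewrite window_meanE // /T -!mulrA ler_pM2l ?ltr0n // ler_pM2l //.
have M4 : window_mean alpha m n 4 <= 24 * T * ((20 / 19) ^+ 2) ^+ 2.
  rewrite window_meanE // /T -!mulrA ler_pM2l ?ltr0n // ler_pM2l //.
have := @char_fun_moment_bound R alpha alpha01 theta (3 * S) S (S * T / 2) (100 * S ^+ 2 * T)
  m n 1 2 isT isT.
move=> /(_ _ _ _ _)/le_trans; apply.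
- by rewrite !mulr_gt0 ?invr_gt0.
- move=> j; rewrite rising1E rising2E natrM -[j.+1]addn1 natrD.
  have -> : 3 * S * j%:R - S * (j%:R * (j%:R + 1)) = S * (j%:R * (2 - j%:R)) by ring.
  case: j => [|[|j]]; first by rewrite mul0r mulr0 sqr_ge0.
    by rewrite mulr1 -ES; lra.
  apply: (@le_trans _ _ 0); last exact: sqr_ge0.
  rewrite -oppr_ge0 -mulrN -mulrN opprB !mulr_ge0 ?subr_ge0 ?ler_nat //.
  exact: ltW.
- have : 3 * S * T <= 3 * S * window_mean alpha m n 1 by rewrite ler_pM2l // mulr_gt0.
  have : S * window_mean alpha m n 2 <= S * (2 * T * (20 / 19) ^+ 2) by rewrite ler_pM2l.
  have : 0 < S * T by rewrite mulr_gt0.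
  by move: (window_mean _ _ _ _) (window_mean _ _ _ _) => x y; lra.
- have S2 : 0 < S ^+ 2 by rewrite exprn_gt0.
  have : S ^+ 2 * window_mean alpha m n 2 <= S ^+ 2 * (2 * T * (20 / 19) ^+ 2) by rewrite ler_pM2l.
  have : S ^+ 2 * window_mean alpha m n 4 <=
         S ^+ 2 * (24 * T * ((20 / 19) ^+ 2) ^+ 2) by rewrite ler_pM2l.
  have : 0 < S ^+ 2 * T by rewrite mulr_gt0.
  rewrite -[(1 + 1)%N]/2%N -[(2 + 2)%N]/4%N exprMn.
  by move: (window_mean _ _ _ _) (window_mean _ _ _ _) => x y; lra.
have -> : 4 * (100 * S ^+ 2 * T) / (S * T / 2) ^+ 2 + 2 / (S * T / 2) = 1600 / T + 4 / (S * T).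
  by field; rewrite !gt_eqF.
apply: (@le_trans _ _ (1604 / (S * T))).
  rewrite -subr_ge0; have -> : 1604 / (S * T) - (1600 / T + 4 / (S * T)) = 1600 * (1 - S) / (S * T).
    by field; rewrite !gt_eqF.
  apply: divr_ge0; last exact: ltW (mulr_gt0 S0 T0).
  by apply: mulr_ge0; [exact: ler0n|rewrite subr_ge0].
rewrite ler_pdivrMr; last exact: mulr_gt0.
have KE (K : R) : K / ((1 - alpha) * n%:R * S) * (S * T) = K * (w%:R / n%:R).
  by rewrite /T; field; rewrite !gt_eqF.
rewrite KE.
have : 1 / 40 <= w%:R / n%:R :> R.
  by rewrite ler_pdivlMr // mulrAC ler_pdivrMr // mul1r -natrM ler_nat mulnC.
by lra.
Qed.

(** If x times the typical size of the clusters born after m is small, then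
    sin^2(theta j) >= x^2 j^2 - x^4 j^4 loses little, and j^2, j^4 may be replaced
    by rising factorials. The condition on x makes the moments of order 4
    and 8, scaled by powers of x, small compared with the one of order 2. *)
Lemma sqr_char_bound_window theta x m n : (0 < m < n)%N -> 0 < x ->
  (forall j : nat, (x * j%:R) ^+ 2 - (x * j%:R) ^+ 4 <= sin (theta * j%:R) ^+ 2) ->
  (forall b, (m <= b < n)%N -> x * growth alpha 1 b n <= 1 / 10) ->
  sqr_char theta n <=
    8 / ((1 - alpha) * x ^+ 2 * \sum_(m <= b < n) growth alpha 2 b n).
Proof.
move=> /andP[m0 mn] x0 Hsin Hx.
set S2 := \sum_(m <= b < n) _; have S20 : 0 < S2.
  apply: lt_le_trans (growth_sum_ge 2 (ltnW mn)); by rewrite ltr0n subn_gt0.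
have x2 : 0 < x ^+ 2 by rewrite exprn_gt0.
have g2 b : (m <= b < n)%N -> x ^+ 2 * growth alpha 2 b n <= 1 / 100.
  move=> mb; apply: (@le_trans _ _ ((x * growth alpha 1 b n) ^+ 2)).
    by rewrite exprMn ler_pM2l // (growth_double alpha01 1).
  have -> : 1 / 100 = (1 / 10) ^+ 2 :> R by lra.
  by rewrite lerXn2r ?nnegrE ?Hx // mulr_ge0 ?growth_ge0 // ltW.
have g4 b : (m <= b < n)%N -> x ^+ 2 * growth alpha 4 b n <= 1 / 100 * growth alpha 2 b n.
  move=> mb; have h0 := growth_ge0 alpha01 2 b n; have h := growth_double alpha01 2 b n.
  apply: (@le_trans _ _ (x ^+ 2 * growth alpha 2 b n ^+ 2)); first by rewrite ler_pM2l.
  by rewrite expr2 mulrA ler_wpM2r ?g2.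
have g8 b : (m <= b < n)%N ->
    x ^+ 6 * growth alpha 8 b n <= 1 / (100 * 100 * 100) * growth alpha 2 b n.
  move=> mb; have h0 := growth_ge0 alpha01 2 b n; have h := growth_double alpha01 4 b n.
  have h4 := g4 b mb; have h2 := g2 b mb; have h40 := growth_ge0 alpha01 4 b n.
  apply: (@le_trans _ _ (x ^+ 2 * (x ^+ 2 * growth alpha 4 b n) ^+ 2)).
    rewrite exprMn mulrA -exprM -exprD ler_pM2l ?exprn_gt0 //.
  apply: (@le_trans _ _ (x ^+ 2 * (1 / 100 * growth alpha 2 b n) ^+ 2)).
    by rewrite ler_pM2l // lerXn2r ?nnegrE // mulr_ge0 // ltW.
  move: (growth _ _ _ _) h0 h2 => g h0 h2.
  have := ler_wpM2r h0 h2; rewrite exprMn; lra.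
set T := (1 - alpha) * x ^+ 2 * S2; have T0 : 0 < T by rewrite !mulr_gt0.
have M2 : x ^+ 2 * window_mean alpha m n 2 = 2 * T.
  by rewrite window_meanE // (_ : (2`!)%:R = 2 :> R) // /T -/S2; ring.
have M4 : x ^+ 4 * window_mean alpha m n 4 <= 24 / 100 * T.
  have -> : x ^+ 4 * window_mean alpha m n 4 = 24 * (1 - alpha) * x ^+ 2 *
     (\sum_(m <= b < n) x ^+ 2 * growth alpha 4 b n).
    by rewrite window_meanE // (_ : (4`!)%:R = 24 :> R) // -mulr_sumr; ring.
  have -> : 24 / 100 * T = 24 * (1 - alpha) * x ^+ 2 *
      (\sum_(m <= b < n) (1 / 100 * growth alpha 2 b n)).
    by rewrite -mulr_sumr /T -/S2; field.
  rewrite ler_pM2l ?mulr_gt0 // big_nat [leRHS]big_nat; exact: ler_sum.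
have M8 : x ^+ 8 * window_mean alpha m n 8 <= T / 20.
  apply: (@le_trans _ _ ((8`!)%:R * (1 / (100 * 100 * 100)) * T)); last first.
    by have := ler_wpM2r (ltW T0) (fact8_le R); lra.
  rewrite window_meanE //; move: (8`!)%:R (ler0n R 8`!) => K K0.
  have -> : x ^+ 8 * (K * (1 - alpha) * \sum_(m <= b < n) growth alpha 8 b n) =
      K * ((1 - alpha) * x ^+ 2 * \sum_(m <= b < n) x ^+ 6 * growth alpha 8 b n).
    by rewrite -mulr_sumr; ring.
  move: (1 / (100 * 100 * 100)) g8 => c g8.
  have -> : K * c * T = K * ((1 - alpha) * x ^+ 2 * \sum_(m <= b < n) c * growth alpha 2 b n).
    by rewrite -mulr_sumr /T -/S2; ring.
  apply: ler_wpM2l => //; apply: ler_wpM2l; first exact: ltW (mulr_gt0 a1 x2).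
  by rewrite big_nat [leRHS]big_nat; apply: ler_sum.
have := @char_fun_moment_bound R alpha alpha01 theta (x ^+ 2 / 2) (x ^+ 4) (T / 2) (T / 4)
  m n 2 4 isT isT.
move=> /(_ _ _ _ _)/le_trans; apply.
- by rewrite divr_gt0.
- move=> j; apply: le_trans (Hsin j).
  rewrite !exprMn lerB //.
    rewrite rising2E -mulrA ler_pM2l // mulrC ler_pdivrMr // -natrX -natrM ler_nat.
    by rewrite -mulnn -mulnA leq_mul2l; case: j => // j; rewrite muln2 -addnn !addSn !ltnS leq_addl.
  by rewrite ler_pM2l ?exprn_gt0 // -natrX ler_nat rising4_ge.
- by move: (window_mean _ _ _ _) (window_mean _ _ _ _) M2 M4 => y z; lra.
- rewrite -[(2 + 2)%N]/4%N -[(4 + 4)%N]/8%N -!exprM expr_div_n -exprM.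
  rewrite -[(2 * 2)%N]/4%N -[(4 * 2)%N]/8%N.
  by move: (window_mean _ _ _ _) (window_mean _ _ _ _) M8 M4 => y z; lra.
by apply: eq_lerW; field; rewrite gt_eqF.
Qed.

End SquaredCharacters.

(** * Summation over the frequencies *)

Section CharacterSum.
Variables (R : realType) (alpha : R).
Hypothesis alpha01 : 0 <= alpha < 1.
Let a1 : 0 < 1 - alpha. Proof. by case/andP: alpha01 => _; rewrite subr_gt0. Qed.

(** The frequency theta acts on all sizes as x does, up to signs, where x is the
    distance from theta to the multiples of pi. *)
Definition sine_like (theta x : R) : Prop :=
  0 < x <= pi / 2 /\ forall j : nat, sin (theta * j%:R) ^+ 2 = sin (x * j%:R) ^+ 2.

Lemma sine_like_sqr_ge theta x : sine_like theta x -> x ^+ 2 / 4 <= sin theta ^+ 2.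
Proof.
case=> /andP[x0 xpi] /(_ 1%N); rewrite !mulr1 => ->.
have -> : x ^+ 2 / 4 = (x / 2) ^+ 2 by rewrite expr_div_n -natrX.
have h : x / 2 <= sin x by apply: half_le_sin; rewrite ltW.
have x2 : 0 <= x / 2 by rewrite divr_ge0 // ltW.
by rewrite lerXn2r // nnegrE // (le_trans x2).
Qed.

Lemma sine_like_sqr_char_le theta x n : (0 < n)%N -> sine_like theta x ->
  sqr_char alpha theta n <= 4 * (350 * 200) / (1 - alpha) / (n%:R * x ^+ 2).
Proof.
move=> n0 sl; have h := sine_like_sqr_ge sl; have [/andP[x0 _] _] := sl.
have nR : 0 < n%:R :> R by rewrite ltr0n.
have x2 : 0 < x ^+ 2 by rewrite exprn_gt0.
have s2 : 0 < sin theta ^+ 2 by apply: lt_le_trans h; rewrite divr_gt0.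
have s0 : sin theta != 0 by apply: contraTneq s2 => ->; rewrite expr0n ltxx.
apply: (le_trans (sqr_char_bound_all alpha01 n0 s0)).
have : 0 <= 350 * 200 :> R by apply: mulr_ge0; apply: ler0n.
move: (350 * 200) => K K0.
have -> : 4 * K / (1 - alpha) / (n%:R * x ^+ 2) = K / ((1 - alpha) * n%:R * (x ^+ 2 / 4)).
  by field; rewrite !gt_eqF.
have D0 : 0 < (1 - alpha) * n%:R := mulr_gt0 a1 nR.
have D1 : 0 < x ^+ 2 / 4 by rewrite divr_gt0.
have D2 := mulr_gt0 D0 D1; have D3 := mulr_gt0 D0 s2.
by apply: ler_wpM2l => //; rewrite lef_pV2 ?posrE // ler_pM2l.
Qed.

(** Cauchy-Schwarz. *)
Lemma char_fun_sqr_le l n k :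
  char_fun l alpha n k ^+ 2 <= sqr_char alpha (angle R l k) n.
Proof.
set c := char_fun _ _ _ _.
pose F (s : seq nat) := \prod_(b < n) cos (angle R l k * (count_mem (b : nat) s)%:R).
have cE : c = Eroots alpha n F by [].
have -> : sqr_char alpha (angle R l k) n = Eroots alpha n (fun s => F s ^+ 2).
  by apply: eq_Eroots => s _ _; rewrite /F -prodrXl.
rewrite -subr_ge0.
have -> : Eroots alpha n (fun s => F s ^+ 2) - c ^+ 2 = Eroots alpha n (fun s => (F s - c) ^+ 2).
  transitivity (Eroots alpha n (fun s => - (2 * c) * F s + (F s ^+ 2 + c ^+ 2))).
    by rewrite Eroots_linear ErootsD Eroots_const -cE; ring.
  by apply: eq_Eroots => s _ _; ring.
by apply: (Eroots_ge0 alpha01) => s; apply: sqr_ge0.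
Qed.

(** For L odd, h = (L + 1) / 2 satisfies 2 h = L + 1, so 2 pi k h / L equals
    pi k + pi k / L: up to signs, the frequencies become pi k / L. This is where
    the parity of L matters; for even L the frequency pi would not decay. *)
Lemma odd_angle l k j : odd l ->
  sin (angle R l (k * l.+2./2.+1) * j%:R) ^+ 2 = sin (pi * k%:R / l.+2%:R * j%:R) ^+ 2.
Proof.
move=> ol.
have LR : l.+2%:R != 0 :> R by rewrite pnatr_eq0.
have h2 : (l.+2./2.+1)%:R * 2 = l.+2%:R + 1 :> R.
  rewrite -natrM natr1; congr (_%:R); rewrite mulSn -[in RHS](odd_double_half l.+2) /= ol.
  by rewrite -muln2; lia.
have -> : angle R l (k * l.+2./2.+1) * j%:R = pi * k%:R / l.+2%:R * j%:R + pi * (k * j)%:R :> R.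
  rewrite /angle natrM natrM.
  transitivity ((pi : R) * (k%:R * (l.+2./2.+1%:R * 2)) / l.+2%:R * j%:R); first by field.
  by rewrite h2; move: (l.+2%:R) LR => x x0; field.
by rewrite sinDpi_nat exprMn -exprM mulnC exprM sqrrN !expr1n mul1r.
Qed.

Lemma sine_like_odd l k : odd l -> (0 < k < l.+2)%N ->
  sine_like (angle R l (k * l.+2./2.+1)) (pi * (minn k (l.+2 - k))%:R / l.+2%:R).
Proof.
move=> ol /andP[k0 kL]; have LR : 0 < l.+2%:R :> R by rewrite ltr0n.
split.
  apply/andP; split.
    by rewrite divr_gt0 ?mulr_gt0 ?pi_gt0 // ltr0n leq_min k0 subn_gt0.
  rewrite ler_pdivrMr // mulrAC ler_pdivlMr // -mulrA ler_pM2l ?pi_gt0 // -natrM ler_nat.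
  by rewrite /minn; case: ltnP; lia.
move=> j; rewrite odd_angle //; rewrite /minn; case: ltnP => // _.
have -> : pi * (l.+2 - k)%:R / l.+2%:R * j%:R = - (pi * k%:R / l.+2%:R * j%:R) + pi * j%:R :> R.
  by rewrite natrB ?(ltnW kL) //; field; rewrite gt_eqF.
by rewrite sinDpi_nat exprMn -exprM mulnC exprM sqrrN !expr1n mul1r sinN sqrrN.
Qed.

(** The frequencies k and L - k behave alike, so it is enough to bound those
    with pi k / L at most pi / 2; a bound summable in k gives one for
    the squared L2-distance. *)
Lemma chi2_le l (W : cyclic_srrw l.+2 alpha) n (C p : R) : (0 < n)%N -> odd l ->
  0 <= C -> 1 < p ->
  (forall j theta, (0 < j)%N -> sine_like theta (pi * j%:R / l.+2%:R) ->
     sqr_char alpha theta n <= C * j%:R `^ (- p)) ->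
  chi2 W n <= 2 * C * (p / (p - 1)).
Proof.
move=> n0 ol C0 p1 H.
have cop : coprime l.+2 l.+2./2.+1.
  have e : ((l.+2./2.+1) * 2 = l.+2 + 1)%N.
    by rewrite mulSn -[in RHS](odd_double_half l.+2) /= ol -muln2; lia.
  rewrite /coprime -dvdn1.
  have : (gcdn l.+2 l.+2./2.+1 %| l.+2 + 1)%N by rewrite -e dvdn_mulr // dvdn_gcdr.
  by rewrite dvdn_addr // dvdn_gcdl.
rewrite (chi2E W n0 cop).
apply: (@le_trans _ _ (\sum_(1 <= k < l.+2) (C * k%:R `^ (- p) + C * (l.+2 - k)%:R `^ (- p)))).
  rewrite big_nat [leRHS]big_nat; apply: ler_sum => k kL.
  apply: (le_trans (char_fun_sqr_le l n _)).
  have sl := sine_like_odd ol kL.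
  apply: (@le_trans _ _ (C * (minn k (l.+2 - k))%:R `^ (- p))).
    apply: H => //; rewrite leq_min; case/andP: kL => -> kL /=.
    by rewrite subn_gt0.
  rewrite /minn; case: ltnP => _.
    by rewrite lerDl mulr_ge0 ?powR_ge0.
  by rewrite lerDr mulr_ge0 ?powR_ge0.
rewrite big_split /=.
have -> : \sum_(1 <= k < l.+2) C * (l.+2 - k)%:R `^ (- p) = \sum_(1 <= k < l.+2) C * k%:R `^ (- p).
  rewrite [RHS]big_nat_rev /=; apply: eq_big_nat => k /andP[k0 kL].
  by rewrite add1n subSS.
rewrite -mulr_sumr; have := sum_powR_le l.+2 p1; set s := \sum_(_ <= _ < _) _ => sp.
have -> : C * s + C * s = 2 * C * s by ring.
by apply: ler_wpM2l => //; rewrite mulr_ge0.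
Qed.

End CharacterSum.

(** * The superdiffusive regime *)

Lemma window_end_le m b : (0 < m)%N -> (b < 2 * m)%N -> (b.+3 <= 4 * m)%N.
Proof. lia. Qed.

Lemma ler_div_common_factor (R : realFieldType) (k a n x t : R) :
  0 < n -> 0 < x -> 0 < t -> k * t <= a * x -> k / (n * x) <= a / (n * t).
Proof.
move=> n0 x0 t0 h.
have -> : k / (n * x) = k * t / (n * x * t) by field; rewrite !gt_eqF.
have -> : a / (n * t) = a * x / (n * x * t) by field; rewrite !gt_eqF.
by rewrite ler_pM2r // invr_gt0 !mulr_gt0.
Qed.

Section Regimes.
Variables (R : realType) (alpha : R).
Hypothesis alpha01 : 0 <= alpha < 1.
Let a1 : 0 < 1 - alpha. Proof. by case/andP: alpha01 => _; rewrite subr_gt0. Qed.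

(** The window starts at m of order n x^(1 / alpha), where clusters have size of
    order 1 / x; those born in [m, 2m) already contribute m up to a constant. The
    numbers 10 and 1/160 are only meant to leave room: they ensure that
    x times the growth factor is at most 1/10 and that 2 m <= n. *)
Lemma sqr_char_superdiffusive : 2^-1 < alpha -> exists2 A : R, 0 < A &
  forall theta x n, (0 < n)%N -> sine_like theta x ->
    sqr_char alpha theta n <= A / (n%:R * x `^ alpha^-1).
Proof.
move=> ah; have a0 : 0 < alpha by apply: lt_trans ah; rewrite invr_gt0.
pose q := alpha^-1; have q1 : 1 <= q by rewrite invf_ge1 //; case/andP: alpha01 => _ /ltW.
have q0 : 0 <= q := le_trans ler01 q1.
have q2 : q <= 2 by rewrite -[2]invrK lef_pV2 ?posrE ?invr_gt0 // ltW.
have [K KE] : exists K : R, K = 4 * (350 * 200) / (1 - alpha) by eexists.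
have K0 : 0 <= K.
  by rewrite KE; apply: divr_ge0; [do ?apply: mulr_ge0; exact: ler0n|exact: ltW].
have [A2 A2E] : exists A2 : R, A2 = 8 * (8 * 80) / (1 - alpha) by eexists.
have A20 : 0 < A2.
  by rewrite A2E; apply: divr_gt0 => //; do ?apply: mulr_gt0; rewrite ltr0n.
have KK : 0 <= K * (4 * (160 * 160)).
  by apply: mulr_ge0 => //; do ?apply: mulr_ge0; exact: ler0n.
pose A := 1 + K * (4 * (160 * 160)) + A2.
have A1 : 1 <= A by rewrite /A -addrA lerDl; apply: addr_ge0 KK (ltW A20).
exists A; first exact: lt_le_trans ltr01 A1.
move=> theta x n n0 sl; have [/andP[x0 xpi] sinE] := sl.
have nR : 0 < n%:R :> R by rewrite ltr0n.
set t := x `^ q; have t0 : 0 < t by rewrite powR_gt0.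
have nt : 0 < n%:R * t by rewrite mulr_gt0.
case: (leP (1 / 160) x) => xs.
  apply: (le_trans (sine_like_sqr_char_le alpha01 n0 sl)); rewrite -KE.
  have x2 : 0 < x ^+ 2 by rewrite exprn_gt0.
  have t4 : t <= 4.
    apply: (@le_trans _ _ (2 `^ q)).
      apply: ge0_ler_powR => //; rewrite ?nnegrE ?ltW //.
      by apply: (le_lt_trans xpi); exact: pihalf_lt2.
    apply: (@le_trans _ _ (2 `^ 2)); first by apply: ler_powR => //; rewrite ler1n.
    by rewrite powR_mulrn // -natrX.
  apply: ler_div_common_factor => //.
  have x160 : 1 / (160 * 160) <= x ^+ 2.
    have -> : 1 / (160 * 160) = (1 / 160) ^+ 2 :> R by lra.
    have h0 : 0 <= 1 / 160 :> R by apply: divr_ge0; [exact: ler01|exact: ler0n].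
    by rewrite lerXn2r ?nnegrE ?h0 ?(ltW x0).
  apply: (@le_trans _ _ (K * 4)); first exact: ler_wpM2l.
  apply: (@le_trans _ _ (K * (4 * (160 * 160)) * x ^+ 2)).
    by have := ler_wpM2l K0 x160; lra.
  rewrite ler_pM2r // /A addrAC lerDr; apply: addr_ge0 (ltW A20); exact: ler01.
apply: sqr_char_le => // Ant.
have {Ant} nt1 : 1 < n%:R * t.
  by apply: le_lt_trans A1 _; move: Ant; rewrite ltr_pdivrMr // mul1r.
(* The window starts at n z, where z^alpha = 10 x. *)
set z := (10 * x) `^ q.
have y0 : 0 < 10 * x by rewrite mulr_gt0.
have y16 : 10 * x <= 1 / 16 by lra.
have z0 : 0 < z by rewrite powR_gt0.
have za : z `^ alpha = 10 * x.
  by rewrite -powRrM mulVf ?gt_eqF // powRr1 // ltW.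
have zt : 10 * t <= z.
  rewrite /z powRM ?(ltW x0) // ler_pM2r //; apply: le1r_powR => //.
  by rewrite ler1n.
have z16 : z <= 1 / 16.
  apply: le_trans y16; apply: ge1r_powR => //; rewrite y0 /=; lra.
have nz10 : 10 <= n%:R * z.
  have : n%:R * (10 * t) <= n%:R * z by rewrite ler_pM2l.
  by lra.
set m := (Num.truncn (n%:R * z)).+1.
have m1 : n%:R * z < m%:R by apply: truncnS_gt.
have m2 : m%:R <= 2 * (n%:R * z).
  rewrite /m -natr1; have : (Num.truncn (n%:R * z))%:R <= n%:R * z.
    by rewrite truncn_le // mulr_ge0 // ltW.
  by lra.
have mR : 0 < m%:R :> R by rewrite ltr0n.
have m2n : (2 * m <= n)%N.
  rewrite -(ler_nat R) natrM; have : n%:R * z <= n%:R * (1 / 16) by rewrite ler_pM2l.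
  by lra.
have mn : (0 < m < n)%N.
  by rewrite ltn0Sn /=; apply: leq_trans m2n; rewrite mul2n -addnn -[ltnLHS]addn0 ltn_add2l.
have Hsin j : (x * j%:R) ^+ 2 - (x * j%:R) ^+ 4 <= sin (theta * j%:R) ^+ 2.
  by rewrite sinE; apply: sqr_sin_ge; rewrite mulr_ge0 // ltW.
have Hg b : (m <= b < n)%N -> x * growth alpha 1 b n <= 1 / 10.
  move=> /andP[mb bn]; have b0 : (0 < b)%N by apply: leq_trans mb.
  have bR : 0 < b%:R :> R by rewrite ltr0n.
  have g : growth alpha 1 b n <= z^-1 `^ alpha.
    have h : (0 < b < n)%N by rewrite b0.
    apply: (le_trans (growth_le_ratio alpha01 1 h)); rewrite mulr1.
    apply: ge0_ler_powR; rewrite ?nnegrE ?divr_ge0 ?invr_ge0 ?(ltW a0) ?(ltW z0) //.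
    rewrite ler_pdivrMr // ler_pdivlMl // mulrC.
    by apply: (le_trans (ltW m1)); rewrite ler_nat.
  apply: (@le_trans _ _ (x * z^-1 `^ alpha)); first by rewrite ler_pM2l.
  rewrite -powR_inv1 ?(ltW z0) // powRAC za powR_inv1 ?(ltW y0) //.
  by apply: eq_lerW; field; rewrite gt_eqF.
apply: (le_trans (sqr_char_bound_window alpha01 mn x0 Hsin Hg)).
have x2 : 0 < x ^+ 2 by rewrite exprn_gt0.
set S2 := \sum_(m <= b < n) _.
have S2ge : m%:R / (80 * x) ^+ 2 <= S2.
  have Hb b : (m <= b < 2 * m)%N -> 1 / (80 * x) ^+ 2 <= growth alpha 2 b n.
    move=> /andP[mb b2m].
    have bn : (b < n)%N by apply: leq_trans b2m m2n.
    apply: le_trans (growth2_ge_ratio alpha01 bn).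
    apply: (@le_trans _ _ ((8 * z)^-1 `^ (alpha * 2))); last first.
      apply: ge0_ler_powR; rewrite ?nnegrE ?divr_ge0 ?invr_ge0 ?mulr_ge0 ?(ltW a0) ?(ltW z0) //.
      rewrite ler_pdivlMr ?addn3 // ler_pdivrMl ?mulr_gt0 //.
      apply: (@le_trans _ _ (4 * m)%:R); last by rewrite natrM; lra.
      by rewrite ler_nat; exact: window_end_le.
    rewrite powRrM powR_mulrn ?powR_ge0 // -[(8 * z)^-1]powR_inv1 ?mulr_ge0 ?(ltW z0) // powRAC.
    rewrite powRM ?(ltW z0) // za powR_inv1 ?mulr_ge0 ?powR_ge0 ?(ltW y0) ?(ltW x0) //.
    rewrite -[(_ * (10 * x))^-1]div1r expr_div_n expr1n !div1r.
    have e0 : 0 < 8 `^ alpha :> R by rewrite powR_gt0.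
    rewrite lef_pV2 ?posrE ?exprn_gt0 ?mulr_gt0 //.
    have e8 : 8 `^ alpha <= 8 :> R.
      by apply: ler1_powR; [rewrite ler1n|case/andP: alpha01 => _ /ltW].
    have -> : 80 * x = 8 * (10 * x) by lra.
    by rewrite lerXn2r ?nnegrE ?mulr_ge0 ?(ltW e0) ?(ltW x0) // ler_pM2r.
  have m2m : (m <= 2 * m)%N by rewrite leq_pmull.
  rewrite /S2 (@big_cat_nat _ _ _ (2 * m)) //=.
  apply: (@le_trans _ _ (\sum_(m <= b < 2 * m) growth alpha 2 b n)); last first.
    by rewrite lerDl sumr_ge0 // => b _; rewrite growth_ge0.
  have -> : m%:R / (80 * x) ^+ 2 = \sum_(m <= b < 2 * m) (1 / (80 * x) ^+ 2).
    by rewrite sumr_const_nat mul2n -addnn addnK div1r mulr_natl.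
  by rewrite big_nat [leRHS]big_nat; apply: ler_sum.
have D0 : 0 < (1 - alpha) * x ^+ 2 := mulr_gt0 a1 x2.
have S20 : 0 < S2 by apply: lt_le_trans S2ge; rewrite divr_gt0 // exprn_gt0 // mulr_gt0.
apply: (@le_trans _ _ (A2 / (n%:R * t))); last first.
  by rewrite ler_pM2r ?invr_gt0 // /A lerDr; apply: addr_ge0 ler01 KK.
rewrite ler_pdivrMr ?mulr_gt0 // mulrAC ler_pdivlMr //.
have h : n%:R * t / (8 * 80) <= x ^+ 2 * S2.
  apply: (@le_trans _ _ (x ^+ 2 * (m%:R / (80 * x) ^+ 2))); last by rewrite ler_pM2l.
  have -> : x ^+ 2 * (m%:R / (80 * x) ^+ 2) = m%:R / 80 / 80 by field; rewrite gt_eqF.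
  have : n%:R * (10 * t) <= n%:R * z by rewrite ler_pM2l.
  by lra.
have -> : A2 * ((1 - alpha) * x ^+ 2 * S2) = 8 * (8 * 80 * (x ^+ 2 * S2)).
  by rewrite A2E; field; rewrite gt_eqF.
by lra.
Qed.

End Regimes.

(** * The critical regime *)

Section Critical.
Variables (R : realType) (alpha : R).
Hypothesis alpha01 : 0 <= alpha < 1.
Hypothesis alpha_half : alpha = 2^-1.

(** Here the window starts at m of order n x^2, and every scale between m and n
    contributes equally, whence the logarithm of n / m; the frequencies with
    x^2 <= 16 / L are those for which it is of order ln L. *)
Lemma sqr_char_critical (L theta x : R) n : (0 < n)%N -> sine_like theta x ->
  0 < L -> 0 < ln L -> 16 * (100 + ln L) <= Num.sqrt L -> x ^+ 2 <= 16 / L ->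
  sqr_char alpha theta n <= 32 / (n%:R * (x ^+ 2 * ln L)).
Proof.
move=> n0 sl L0 lnL0 Lbig xL; have [/andP[x0 xpi] sinE] := sl.
have nR : 0 < n%:R :> R by rewrite ltr0n.
have x2 : 0 < x ^+ 2 by rewrite exprn_gt0.
have P0 : 0 < n%:R * (x ^+ 2 * ln L) by apply: mulr_gt0 => //; apply: mulr_gt0.
apply: sqr_char_le => // /[!ltr_pdivrMr] // /[!mul1r] big.
set r := Num.sqrt L in Lbig *; have r0 : 0 < r by rewrite sqrtr_gt0.
have rL : r * r = L by rewrite -expr2 sqr_sqrtr // ltW.
have r1 : 1 < r by lra.
have lnr : ln L = 2 * ln r by rewrite -rL lnM ?posrE // mulrDl mul1r.
set m := (Num.truncn (100 * (n%:R * x ^+ 2))).+1.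
have nx0 : 0 <= 100 * (n%:R * x ^+ 2) by apply: mulr_ge0 => //; apply: mulr_ge0; exact: ltW.
have m1 : 100 * (n%:R * x ^+ 2) < m%:R by apply: truncnS_gt.
have m2 : m%:R <= 100 * (n%:R * x ^+ 2) + 1.
  by rewrite /m -natr1 lerD2r truncn_le.
have mR : 0 < m%:R :> R by rewrite ltr0n.
have m3 : (m + 3)%:R * r <= n%:R.
  have h1 : (m + 3)%:R <= n%:R * x ^+ 2 * (100 + ln L).
    by rewrite natrD; move: big; rewrite mulrA; lra.
  have h2 : n%:R * x ^+ 2 * (100 + ln L) <= n%:R * (16 / L) * (100 + ln L).
    by rewrite ler_pM2r ?ler_pM2l //; lra.
  have h3 : n%:R * (16 / L) * (100 + ln L) <= n%:R / L * r.
    have -> : n%:R * (16 / L) * (100 + ln L) = n%:R / L * (16 * (100 + ln L)) by ring.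
    by rewrite ler_pM2l // divr_gt0.
  apply: (@le_trans _ _ (n%:R / L * r * r)).
    by rewrite ler_pM2r //; apply: le_trans h3; apply: le_trans h2.
  by rewrite -mulrA rL divfK // gt_eqF.
have mn : (0 < m < n)%N.
  rewrite ltn0Sn /= -(ltr_nat R); apply: lt_le_trans m3.
  have : m%:R * 1 < m%:R * r by rewrite ltr_pM2l.
  by rewrite natrD mulrDl; lra.
have Hsin j : (x * j%:R) ^+ 2 - (x * j%:R) ^+ 4 <= sin (theta * j%:R) ^+ 2.
  by rewrite sinE; apply: sqr_sin_ge; rewrite mulr_ge0 // ltW.
have Hg b : (m <= b < n)%N -> x * growth alpha 1 b n <= 1 / 10.
  move=> /andP[mb bn]; have b0 : (0 < b)%N by apply: leq_trans mb.
  have bR : 0 < b%:R :> R by rewrite ltr0n.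
  have h : (0 < b < n)%N by rewrite b0.
  apply: (@le_trans _ _ (x * ((10 * x)^-1 `^ 2) `^ alpha)).
    rewrite ler_pM2l //; apply: (le_trans (growth_le_ratio alpha01 1 h)); rewrite mulr1.
    have x10 : 0 < 10 * x by rewrite mulr_gt0.
    apply: ge0_ler_powR; rewrite ?nnegrE ?divr_ge0 ?powR_ge0 //; first by case/andP: alpha01.
    rewrite powR_mulrn ?invr_ge0 ?(ltW x10) // -[(10 * x)^-1]div1r expr_div_n expr1n.
    rewrite ler_pdivrMr // mulrAC ler_pdivlMr ?exprn_gt0 // mul1r exprMn.
    have mbR : m%:R <= b%:R :> R by rewrite ler_nat.
    by move: m1 mbR; lra.
  rewrite -powRrM alpha_half divff // powRr1 ?invr_ge0 ?mulr_ge0 ?(ltW x0) //.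
  by apply: eq_lerW; field; rewrite gt_eqF.
apply: (le_trans (sqr_char_bound_window alpha01 mn x0 Hsin Hg)).
set S2 := \sum_(m <= b < n) _.
have m30 : 0 < (m + 3)%:R :> R by rewrite addn3.
have n30 : 0 < (n + 3)%:R :> R by rewrite addn3.
have S2ge : n%:R * (ln L / 2) <= S2.
  apply: (@le_trans _ _ (n%:R * \sum_(m <= b < n) (b + 3)%:R^-1)).
    rewrite ler_pM2l //; apply: le_trans (ln_le_sum_inv R 2 (_ : m <= n)%N); last first.
      by case/andP: mn => _ /ltnW.
    have h : ln (r * (m + 3)%:R) <= ln (n + 3)%:R.
      rewrite ler_ln ?posrE ?mulr_gt0 //; rewrite mulrC; apply: (le_trans m3).
      by rewrite ler_nat leq_addr.
    by move: h; rewrite lnM ?posrE // lnr; move: (ln _) (ln _) (ln _) => y z w; lra.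
  rewrite mulr_sumr /S2 big_nat [leRHS]big_nat; apply: ler_sum => b /andP[mb bn].
  apply: le_trans (growth2_ge_ratio alpha01 bn).
  by rewrite alpha_half mulVf // powRr1 // divr_ge0.
have D0 : 0 < n%:R * (ln L / 2) by rewrite mulr_gt0 // divr_gt0.
have S20 := lt_le_trans D0 S2ge.
have xS : 0 < x ^+ 2 * S2 := mulr_gt0 x2 S20.
have -> : 1 - alpha = 1 / 2 by rewrite alpha_half; lra.
rewrite ler_pdivrMr; last by rewrite -mulrA mulr_gt0 // divr_gt0.
rewrite mulrAC ler_pdivlMr //.
have := ler_wpM2l (ltW x2) S2ge.
by clearbody S2; move: (ln L) => e; lra.
Qed.

Lemma growth_critical b n : (b < n)%N -> growth alpha 2 b n = n%:R / b.+1%:R.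
Proof.
case: n => // n; rewrite ltnS; elim: n => [|n IH].
  by rewrite leqn0 => /eqP ->; rewrite /growth big_geq // divff.
rewrite leq_eqVlt => /predU1P[->|bn]; first by rewrite /growth big_geq // divff.
rewrite /growth big_nat_recr //= -/(growth _ _ _ _) IH // alpha_half mulVf //.
have : n.+1%:R != 0 :> R by rewrite pnatr_eq0.
rewrite -[in X in _ -> _ = X]natr1; move: (n.+1%:R) => y y0.
by field; rewrite y0 nat1r pnatr_eq0.
Qed.

Lemma window_mean_critical n : (0 < n)%N ->
  window_mean alpha 0 n 2 <= 2 * n%:R * (1 + ln n%:R).
Proof.
move=> n0; rewrite /window_mean (_ : (2`!)%:R = 2 :> R) // -mulrA ler_pM2l //.
apply: le_trans (ler_wpM2l (ler0n R n) (sum_inv_le_ln R n0)).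
rewrite mulr_sumr big_nat [leRHS]big_nat; apply: ler_sum => b /andP[_ bn].
rewrite growth_critical // -[leRHS]mul1r ler_wpM2r ?divr_ge0 //.
exact: fresh_prob_le1.
Qed.

End Critical.

(** * Second moments of the clusters *)

Section SecondMoment.
Variables (R : realType) (alpha : R).
Hypothesis alpha01 : 0 <= alpha < 1.
Let a0 : 0 <= alpha. Proof. by case/andP: alpha01. Qed.

Lemma second_moment_le n :
  Eroots alpha n (fun s => \sum_(b < n) (count_mem (b : nat) s)%:R ^+ 2) <=
  window_mean alpha 0 n 2.
Proof.
rewrite /window_mean -(@Ecluster_momentE R alpha 0 n 2 n) //.
apply: (le_Eroots alpha01) => s _ _; rewrite /cluster_moment.
rewrite -(big_mkord xpredT (fun b => (count_mem b s)%:R ^+ 2)).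
by apply: ler_sum => b _; rewrite rising2E -natrX ler_nat -mulnn leq_mul.
Qed.

(** A linear bound K t is preserved by the recursion of Ecluster_moment_S as
    soon as K (1 - 2 alpha) is at least 2. *)
Lemma window_mean_subcritical n : alpha < 2^-1 ->
  window_mean alpha 0 n 2 <= 2 / (1 - 2 * alpha) * n%:R.
Proof.
move=> ah; have d0 : 0 < 1 - 2 * alpha by lra.
rewrite /window_mean -(@Ecluster_momentE R alpha 0 n 2 n) //.
suff H t : (t <= n)%N ->
    Eroots alpha t (cluster_moment R 0 n 2) <= 2 / (1 - 2 * alpha) * t%:R by exact: H.
set K := 2 / _; have KE : K * (1 - 2 * alpha) = 2 by rewrite divfK // gt_eqF.
elim: t => [|t IH] tn.
  by rewrite /= /cluster_moment mulr0 big1 // => b _; rewrite rising0.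
rewrite Ecluster_moment_S // tn mulr1 (_ : (2`!)%:R = 2 :> R) //.
have f1 := fresh_prob_le1 alpha01 t.
have c0 : 0 <= 1 + alpha * 2 / t%:R by rewrite addr_ge0 // !mulr_ge0 ?invr_ge0.
have {}IH := ler_wpM2l c0 (IH (ltnW tn)).
apply: (@le_trans _ _ ((1 + alpha * 2 / t%:R) * (K * t%:R) + 2)).
  by apply: lerD => //; lra.
have K0 : 0 <= K by rewrite divr_ge0 // ltW.
have h : alpha * 2 / t%:R * (K * t%:R) <= 2 * alpha * K.
  case: (posnP t) => [->|t0].
    by rewrite !mulr0; exact: mulr_ge0 (mulr_ge0 (ler0n _ 2) a0) K0.
  by apply: eq_lerW; field; rewrite pnatr_eq0 -lt0n.
by rewrite -natr1; move: h; lra.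
Qed.

(** The early clusters dominate, since the sum of the b^(-2 alpha) converges. *)
Lemma window_mean_supercritical : 2^-1 < alpha -> exists2 C : R, 0 < C &
  forall n, window_mean alpha 0 n 2 <= C * n%:R `^ (alpha * 2).
Proof.
move=> ah; have p1 : 1 < alpha * 2 by lra.
have a1 : alpha < 1 by case/andP: alpha01.
pose C := 3 + alpha * 2 / (alpha * 2 - 1).
have C0 : 0 < C by rewrite /C ltr_pwDl // divr_ge0 ?mulr_ge0 // subr_ge0 ltW.
exists (2 * C); first by rewrite mulr_gt0.
move=> n; rewrite /window_mean (_ : (2`!)%:R = 2 :> R) // -mulrA ler_pM2l //.
case: n => [|n]; first by rewrite big_geq // mulr_ge0 ?powR_ge0 // ltW.
rewrite big_ltn //= mul1r /C mulrDl; apply: lerD.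
  case: n => [|n]; first by rewrite /growth big_geq // powR1; lra.
  rewrite /growth big_ltn // -/(growth _ _ _ _) divr1.
  apply: ler_pM; rewrite ?growth_ge0 //; [by rewrite addr_ge0 // mulr_ge0|by lra|].
  by have := growth_le_ratio alpha01 2 (isT : (0 < 1 < n.+2)%N); rewrite divr1.
have := sum_powR_le n.+1 p1 => h.
apply: le_trans (ler_wpM2r (powR_ge0 _ _) h).
rewrite mulr_suml big_nat [leRHS]big_nat; apply: ler_sum => b /andP[b1 bn].
apply: (@le_trans _ _ (1 * growth alpha 2 b n.+1)).
  by rewrite ler_wpM2r ?growth_ge0 //; exact: fresh_prob_le1.
have hb : (0 < b < n.+1)%N by rewrite b1.
rewrite mul1r; apply: (le_trans (growth_le_ratio alpha01 2 hb)).
by rewrite powRM ?invr_ge0 // mulrC -[b%:R^-1]powR_inv1 // -powRrM mulN1r.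
Qed.

End SecondMoment.

(** * Total variation distance *)

Section TotalVariation.
Variables (R : realType) (T : finType) (p : T -> R).
Hypothesis T0 : (0 < #|T|)%N.
Hypothesis p0 : forall g, 0 <= p g.
Hypothesis p1 : \sum_g p g = 1.
Local Notation u := (#|T|%:R^-1 : R).
Local Notation chi2p := (#|T|%:R * (\sum_g p g ^+ 2) - 1).
Local Notation TV := (total_variation_dist p (@uniform_pmf R T)).

Let cR : 0 < #|T|%:R :> R. Proof. by rewrite ltr0n. Qed.
Let u0 : 0 < u. Proof. by rewrite invr_gt0. Qed.

Let sum_u : \sum_(g : T) u = 1.
Proof. by rewrite sumr_const -(mulr_natl u) divff // gt_eqF. Qed.

Lemma tv_ge0 : 0 <= TV.
Proof. by rewrite mulr_ge0 ?invr_ge0 // sumr_ge0. Qed.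

Lemma tv_sqr_le : 4 * TV ^+ 2 <= chi2p.
Proof.
rewrite /total_variation_dist /uniform_pmf; set s := \sum_g `|_|.
have -> : 4 * (2^-1 * s) ^+ 2 = s ^+ 2 by field.
have E : \sum_g (p g - u) ^+ 2 = \sum_g p g ^+ 2 - u.
  transitivity (\sum_g (p g ^+ 2 - 2 * u * p g + u * u)).
    by apply: eq_bigr => g _; ring.
  rewrite big_split sumrB -!mulr_sumr p1 /= sum_u; ring.
have h : 0 <= \sum_g (`|p g - u| - u * s) ^+ 2.
  by apply: sumr_ge0 => g _; apply: sqr_ge0.
have E2 : \sum_g (`|p g - u| - u * s) ^+ 2 = \sum_g p g ^+ 2 - u - u * s ^+ 2.
  transitivity (\sum_g ((p g - u) ^+ 2 - 2 * (u * s) * `|p g - u| + u * s ^+ 2 * u)).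
    by apply: eq_bigr => g _; rewrite sqrrB real_normK ?num_real //; ring.
  rewrite big_split sumrB -!mulr_sumr E -/s /= sum_u; ring.
rewrite E2 in h; have := mulr_ge0 (ltW cR) h.
have -> : #|T|%:R * (\sum_g p g ^+ 2 - u - u * s ^+ 2) = chi2p - s ^+ 2.
  by field; rewrite gt_eqF.
by rewrite subr_ge0.
Qed.

(** The overlap of p and u is at least the sum of the
    lam p - lam^2 p^2 / (4 u), for any lam in [0, 1], because this is at most both
    p and u; the choice lam = 1 / (1 + X) makes this sum positive. *)
Lemma tv_le_overlap X : 0 <= X -> chi2p <= X -> TV <= 1 - 1 / (2 * (1 + X)).
Proof.
move=> X0 hX; have d0 : 0 < 1 + X by lra.
set lam := (1 + X)^-1; have l0 : 0 < lam by rewrite invr_gt0.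
have l1 : lam <= 1 by rewrite invf_le1 // lerDl.
(* The absolute difference of p and u is p + u minus twice their minimum. *)
have H g : `|p g - u| <= p g + u - 2 * (lam * p g - lam ^+ 2 * (#|T|%:R * p g ^+ 2) / 4).
  have key : lam * p g - lam ^+ 2 * (#|T|%:R * p g ^+ 2) / 4 <= u.
    rewrite -subr_ge0.
    have -> : u - (lam * p g - lam ^+ 2 * (#|T|%:R * p g ^+ 2) / 4)
            = u * (1 - #|T|%:R * p g * lam / 2) ^+ 2 by field; rewrite gt_eqF.
    by rewrite mulr_ge0 ?sqr_ge0 // ltW.
  have key2 : lam * p g - lam ^+ 2 * (#|T|%:R * p g ^+ 2) / 4 <= p g.
    have h1 : lam * p g <= p g by apply: ler_piMl.
    have h2 : 0 <= lam ^+ 2 * (#|T|%:R * p g ^+ 2) / 4.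
      by rewrite divr_ge0 // mulr_ge0 ?sqr_ge0 // mulr_ge0 ?sqr_ge0 // ltW.
    by lra.
  by rewrite ler_norml; apply/andP; split; lra.
apply: (@le_trans _ _ (2^-1 * \sum_g (p g + u
    - 2 * (lam * p g - lam ^+ 2 * (#|T|%:R * p g ^+ 2) / 4)))).
  by rewrite ler_pM2l ?invr_gt0 //; apply: ler_sum.
have -> : \sum_g (p g + u - 2 * (lam * p g - lam ^+ 2 * (#|T|%:R * p g ^+ 2) / 4))
   = 2 - 2 * lam + lam ^+ 2 / 2 * (#|T|%:R * \sum_g p g ^+ 2).
  transitivity (\sum_g ((p g + u - 2 * lam * p g) + lam ^+ 2 / 2 * (#|T|%:R * p g ^+ 2))).
    by apply: eq_bigr => g _; field; rewrite gt_eqF.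
  rewrite big_split sumrB big_split /= sum_u -!mulr_sumr p1; ring.
have h : #|T|%:R * \sum_g p g ^+ 2 <= 1 + X by lra.
have : lam ^+ 2 / 2 * (#|T|%:R * \sum_g p g ^+ 2) <= lam / 2.
  apply: (@le_trans _ _ (lam ^+ 2 / 2 * (1 + X))).
    by rewrite ler_pM2l // divr_gt0 // exprn_gt0.
  by apply/eq_lerW; rewrite /lam; field; rewrite gt_eqF.
have -> : 1 / (2 * (1 + X)) = lam / 2 by rewrite /lam; field; rewrite gt_eqF.
lra.
Qed.

Lemma tv_ge_set (B : pred T) : \sum_(g | B g) p g - \sum_(g | B g) u <= TV.
Proof.
have h : \sum_(g | B g) (p g - u) + \sum_(g | ~~ B g) (p g - u) = 0.
  by rewrite -(bigID B predT) /= sumrB p1 sum_u subrr.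
rewrite -sumrB /total_variation_dist /uniform_pmf [X in _ <= _ * X](bigID B) /=.
have h1 : \sum_(g | B g) (p g - u) <= \sum_(g | B g) `|p g - u|.
  by apply: ler_sum => g _; apply: ler_norm.
have h2 : - \sum_(g | ~~ B g) (p g - u) <= \sum_(g | ~~ B g) `|p g - u|.
  by rewrite -sumrN; apply: ler_sum => g _; rewrite -normrN; apply: ler_norm.
have half_split (a b x y : R) : a + b = 0 -> a <= x -> - b <= y -> a <= 2^-1 * (x + y) by lra.
exact: half_split h h1 h2.
Qed.

End TotalVariation.

Section LowerBound.
Variables (R : realType) (alpha : R).
Hypothesis alpha01 : 0 <= alpha < 1.

Lemma one_sub_prod_le (f : nat -> R) n : (forall b, `|f b| <= 1) ->
  1 - \prod_(b < n) f b <= \sum_(b < n) (1 - f b).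
Proof.
move=> f1; suff [] : 1 - \prod_(b < n) f b <= \sum_(b < n) (1 - f b) /\
    \prod_(b < n) f b <= 1 by [].
elim: n => [|n [IH1 IH2]]; first by rewrite !big_ord0 subrr.
have P1 : `|\prod_(b < n) f b| <= 1.
  by rewrite normr_prod; apply: prodr_ile1 => b _; rewrite normr_ge0 f1.
have := f1 n; rewrite ler_norml => /andP[fl fu].
rewrite !big_ord_recr /=; split; last first.
  by apply: le_trans (ler_norm _) _; rewrite normrM mulr_ile1 ?normr_ge0.
move: (\prod_(b < n) _) IH1 IH2 P1 => P IH1 IH2 P1.
have : 0 <= (1 - P) * (1 - f n) by rewrite mulr_ge0 // subr_ge0.
by lra.
Qed.

(** As 1 - cos(theta N) is at most theta^2 N^2 / 2, cluster by cluster. *)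
Lemma one_sub_char_fun_le l n k :
  1 - char_fun l alpha n k <= angle R l k ^+ 2 / 2 *
    Eroots alpha n (fun s => \sum_(b < n) (count_mem (b : nat) s)%:R ^+ 2).
Proof.
rewrite -ErootsZ -{1}(Eroots_const alpha n 1) -mulN1r -ErootsZ -ErootsD.
apply: (le_Eroots alpha01) => s _ _; rewrite mulN1r.
apply: (le_trans (@one_sub_prod_le (fun b => cos (angle R l k * (count_mem b s)%:R)) n _)).
  by move=> b; apply: cos_max.
rewrite mulr_sumr; apply: ler_sum => b _.
by apply: (le_trans (one_sub_cos_le _)); apply: eq_lerW; rewrite exprMn; ring.
Qed.

Lemma sum_le_indic (L D : nat) :
  \sum_(0 <= g < L) ((g <= D)%N%:R : R) <= D.+1%:R.
Proof.
suff -> : \sum_(0 <= g < L) ((g <= D)%N%:R : R) = (minn L D.+1)%:R.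
  by rewrite ler_nat geq_minr.
elim: L => [|L IH]; first by rewrite big_geq // min0n.
rewrite big_nat_recr //= IH -natrD; congr (_%:R).
lia.
Qed.

Lemma one_sub_cos_ge l (g : 'Z_l.+2) :
  2 * ((minn g (l.+2 - g))%:R / l.+2%:R) ^+ 2 <= 1 - chi_re R 1 g.
Proof.
have LR : 0 < l.+2%:R :> R by rewrite ltr0n.
set w := minn _ _; pose y : R := pi * (w%:R / l.+2%:R).
have gl : (g < l.+2)%N := ltn_ord g.
have cE : chi_re R 1 g = cos (y *+ 2).
  rewrite /chi_re /angle /y /w mulr1 /minn; case: ltnP => _.
    by congr cos; rewrite mulr2n; field; rewrite gt_eqF.
  rewrite -[RHS]cosN -[RHS](cosD2pi_nat _ 1); congr cos.
  rewrite mulr1 natrB; last exact: ltnW.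
  by rewrite mulr2n; field; rewrite gt_eqF.
have w0 : 0 <= w%:R / l.+2%:R :> R by rewrite divr_ge0.
have w2 : w%:R / l.+2%:R <= 1 / 2 :> R.
  rewrite ler_pdivrMr // mulrAC ler_pdivlMr // mul1r -natrM ler_nat /w /minn.
  by case: ltnP; move: gl; move: (nat_of_ord g) => i; lia.
have p0 := pi_gt0 R; have p2 := pi_ge2 R.
have hy : 0 <= y <= pi / 2.
  rewrite /y mulr_ge0 ?(ltW p0) //=.
  by apply: (le_trans (ler_wpM2l (ltW p0) w2)); lra.
have hs := half_le_sin hy.
have y0 : 0 <= y by case/andP: hy.
have -> : 1 - chi_re R 1 g = 2 * sin y ^+ 2.
  by rewrite cE cos_mulr2n cos2sin2 (mulr2n (1 - _)); ring.
rewrite ler_pM2l // lerXn2r ?nnegrE //; first by apply: le_trans hs; rewrite divr_ge0.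
apply: le_trans hs; rewrite /y ler_pdivlMr // [leLHS]mulrC.
exact: ler_wpM2r.
Qed.

(** Test against the arc of points at distance at most delta L from 0, of
    uniform mass about 2 delta. By Markov's inequality applied to
    1 - cos(2 pi S_n / L), which is at least 2 delta^2 off the arc, the walk is
    outside with a probability controlled by the second moment. *)
Lemma tv_lower_bound l (W : cyclic_srrw l.+2 alpha) n (delta : R) :
  (0 < n)%N -> 0 < delta ->
  1 - 16 / delta ^+ 2 * (window_mean alpha 0 n 2 / l.+2%:R ^+ 2) - 2 * delta - 2 / l.+2%:R
  <= total_variation_dist (srrw_law W n) (@uniform_pmf R _).
Proof.
move=> n0 d0.
have LR : 0 < l.+2%:R :> R by rewrite ltr0n.
have cT : #|'Z_l.+2| = l.+2 by rewrite card_ord.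
set D := Num.truncn (delta * l.+2%:R).
pose B : pred 'Z_l.+2 := fun g => (minn g (l.+2 - g) <= D)%N.
have sum1 := sum_srrw_law W n0.
apply: le_trans (@tv_ge_set R _ _ _ sum1 B); last by rewrite cT.
have dL0 : 0 <= delta * l.+2%:R by rewrite mulr_ge0 // ltW.
have hB : \sum_(g | B g) (#|'Z_l.+2|%:R^-1 : R) <= 2 * delta + 2 / l.+2%:R.
  pose f (g : nat) : R := ((g <= D)%N%:R + (l.+2 - g <= D)%N%:R) / l.+2%:R.
  apply: (@le_trans _ _ (\sum_(g < l.+2) f g)).
    rewrite big_mkcond cT; apply: ler_sum => g _.
    have f0 : 0 <= f g by rewrite /f; apply: divr_ge0 => //; apply: addr_ge0.
    rewrite /B; case: ifP => // hmin; rewrite /f -[leLHS]mul1r ler_wpM2r ?invr_ge0 //.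
    move: hmin; rewrite /minn; case: ltnP => _ -> /=; first by rewrite lerDl.
    by rewrite lerDr.
  have -> : \sum_(g < l.+2) f g =
      (\sum_(0 <= g < l.+2) (g <= D)%N%:R + \sum_(0 <= g < l.+2) (l.+2 - g <= D)%N%:R)
        / l.+2%:R.
    by rewrite -big_split /= mulr_suml big_mkord.
  have h1 := sum_le_indic l.+2 D.
  have h2 : \sum_(0 <= g < l.+2) ((l.+2 - g <= D)%N%:R : R) <= D.+1%:R.
    apply: le_trans h1; rewrite big_nat_rev /= big_nat [leRHS]big_nat.
    apply: ler_sum => g /andP[_ gL]; rewrite add0n subKn //.
    by rewrite ler_nat; case: (leqP g.+1 D) => // /ltnW ->.
  have hD : D.+1%:R <= delta * l.+2%:R + 1.
    by rewrite -natr1 lerD2r truncn_le.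
  rewrite ler_pdivrMr // mulrDl divfK ?gt_eqF //.
  by move: h1 h2 hD; lra.
have hc : \sum_(g | ~~ B g) srrw_law W n g <=
    16 / delta ^+ 2 * (window_mean alpha 0 n 2 / l.+2%:R ^+ 2).
  have d2 : 0 < 2 * delta ^+ 2 by rewrite mulr_gt0 // exprn_gt0.
  apply: (@le_trans _ _ (\sum_g srrw_law W n g * ((1 - chi_re R 1 g) / (2 * delta ^+ 2)))).
    rewrite big_mkcond; apply: ler_sum => g _.
    have pg := srrw_law_ge0 W n g.
    case: ifP => Bg; last first.
      by rewrite mulr_ge0 // divr_ge0 ?(ltW d2) // subr_ge0; exact: cos_le1.
    rewrite -[leLHS]mulr1; apply: ler_wpM2l => //.
    rewrite ler_pdivlMr // mul1r; apply: le_trans (one_sub_cos_ge g).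
    rewrite ler_pM2l // lerXn2r ?nnegrE ?divr_ge0 ?(ltW d0) //.
    rewrite ler_pdivlMr //; move: Bg; rewrite /B -ltnNge => Dw.
    by apply: (le_trans (ltW (truncnS_gt _))); rewrite ler_nat.
  have -> : \sum_g srrw_law W n g * ((1 - chi_re R 1 g) / (2 * delta ^+ 2)) =
      (1 - char_fun l alpha n 1) / (2 * delta ^+ 2).
    transitivity ((\sum_g srrw_law W n g - \sum_g srrw_law W n g * chi_re R 1 g)
                  / (2 * delta ^+ 2)); last by rewrite sum1 srrw_chi_re.
    rewrite -sumrB mulr_suml; apply: eq_bigr => g _.
    by rewrite mulrA mulrBr mulr1.
  have h1 := one_sub_char_fun_le l n 1.
  have h2 := second_moment_le alpha01 n.
  have hv : 0 <= window_mean alpha 0 n 2.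
    apply: le_trans h2; apply: (Eroots_ge0 alpha01) => s.
    by apply: sumr_ge0 => b _; apply: sqr_ge0.
  have a8 : angle R l 1 ^+ 2 / 2 <= 32 / l.+2%:R ^+ 2.
    rewrite /angle mulr1 expr_div_n mulrAC ler_pM2r ?invr_gt0 ?exprn_gt0 //.
    have p0 := pi_ge0 R; have p4 : pi <= 4 :> R by have := pihalf_lt2 R; lra.
    rewrite exprMn; have : pi ^+ 2 <= 4 ^+ 2 :> R by rewrite lerXn2r ?nnegrE.
    by lra.
  rewrite ler_pdivrMr //.
  have -> : 16 / delta ^+ 2 * (window_mean alpha 0 n 2 / l.+2%:R ^+ 2) * (2 * delta ^+ 2) =
     32 / l.+2%:R ^+ 2 * window_mean alpha 0 n 2.
    by field; rewrite !gt_eqF.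
  apply: (le_trans h1); apply: ler_pM => //.
    by rewrite divr_ge0 // sqr_ge0.
  by apply: (Eroots_ge0 alpha01) => s; apply: sumr_ge0 => b _; apply: sqr_ge0.
have hs : \sum_(g | B g) srrw_law W n g = 1 - \sum_(g | ~~ B g) srrw_law W n g.
  have e := sum1; rewrite (bigID B) /= in e.
  have solve_sum (a b : R) : a + b = 1 -> a = 1 - b by lra.
  exact: solve_sum e.
have combine (x y e a b : R) : x <= e -> y <= a + b -> 1 - e - a - b <= 1 - x - y by lra.
by rewrite hs; exact: combine hc hB.
Qed.

End LowerBound.

(** * Mixing times from a scale *)

Section MixingTime.
Variables (R : realType) (G : finGroupType) (mu : G -> R) (alpha : R).
Variable W : srrw mu alpha.
Local Notation TV m := (total_variation_dist (srrw_law W m) (@uniform_pmf R G)).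

Lemma mixing_time_le eps N : (0 < N)%N ->
  (forall m, (N <= m)%N -> TV m <= eps) -> (mixing_time W eps <= N%:R%:E)%E.
Proof. by move=> N0 H; apply: ereal_inf_lbound; exists N. Qed.

Lemma mixing_time_ge eps (c : R) :
  (forall n, (0 < n)%N -> n%:R <= c -> eps < TV n) -> (c%:E <= mixing_time W eps)%E.
Proof.
move=> H; apply: le_ereal_inf_tmp => y [n [n0 Hn] <-]; rewrite lee_fin leNgt.
apply/negP => nc; have := H n n0 (ltW nc); rewrite ltNge; apply/negP/negPn.
exact: Hn.
Qed.

Lemma mixing_time_ge1 eps : (1%:E <= mixing_time W eps)%E.
Proof. by apply: le_ereal_inf_tmp => y [n [n0 _] <-]; rewrite lee_fin ler1n. Qed.

End MixingTime.

Section Scale.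
Variables (R : realType) (alpha : R).
Hypothesis alpha01 : 0 <= alpha < 1.

(** What is needed of sc(L) to be the order of the mixing time: the squared
    L2-distance to uniformity is at most a multiple of sc(L) / n, and the mean
    of the sum of the squared cluster sizes is small compared with L^2 before a
    small multiple of sc(L). *)
Record mixing_scale (sc : nat -> R) : Prop := MixingScale {
  scale_large : forall K : R, exists L0 : nat, forall L, (L0 <= L)%N -> K <= sc L;
  scale_chi2 : exists2 A : R, 0 < A & exists L0 : nat, forall l, odd l ->
    (L0 <= l.+2)%N -> forall (W : cyclic_srrw l.+2 alpha) n, (0 < n)%N ->
    chi2 W n <= A * sc l.+2 / n%:R;
  scale_moment : forall eta : R, 0 < eta -> exists2 c : R, 0 < c &
    exists L0 : nat, forall L n, (L0 <= L)%N -> (0 < n)%N -> n%:R <= c * sc L ->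
    window_mean alpha 0 n 2 <= eta * L%:R ^+ 2 }.

Variable sc : nat -> R.
Hypothesis Hsc : mixing_scale sc.

Lemma tv_gt_below_scale eps : 0 < eps < 1 -> exists2 c : R, 0 < c &
  exists L0 : nat, forall l, (L0 <= l.+2)%N -> forall (W : cyclic_srrw l.+2 alpha) n,
    (0 < n)%N -> n%:R <= c * sc l.+2 ->
    eps < total_variation_dist (srrw_law W n) (@uniform_pmf R _).
Proof.
case/andP => e0 e1; set d := 1 - eps; have d0 : 0 < d by rewrite subr_gt0.
(* The three errors in tv_lower_bound become at most d/4, d/4 and d/8. *)
pose delta := d / 8; have dl0 : 0 < delta by rewrite divr_gt0.
pose eta := delta ^+ 2 * d / 64.
have eta0 : 0 < eta by rewrite divr_gt0 // mulr_gt0 // exprn_gt0.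
have [c c0 [L0 HL]] := scale_moment Hsc eta0.
exists c => //; exists (maxn L0 (Num.truncn (16 / d)).+1) => l; rewrite geq_max => /andP[l0 l1].
move=> W n n0 nc; apply: lt_le_trans (tv_lower_bound alpha01 W n0 dl0).
have LR : 0 < l.+2%:R :> R by rewrite ltr0n.
have h1 : 16 / delta ^+ 2 * (window_mean alpha 0 n 2 / l.+2%:R ^+ 2) <= d / 4.
  apply: (@le_trans _ _ (16 / delta ^+ 2 * eta)).
    apply: ler_wpM2l; first by rewrite divr_ge0 // sqr_ge0.
    by rewrite ler_pdivrMr ?exprn_gt0 //; apply: HL.
  by apply: eq_lerW; rewrite /eta; field; rewrite gt_eqF.
have h2 : 2 / l.+2%:R <= d / 8.
  have : 16 / d <= l.+2%:R.
    by apply: le_trans (ltW (truncnS_gt _)) _; rewrite ler_nat.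
  by rewrite ler_pdivrMr // ler_pdivrMr //; move: (l.+2%:R : R) => z; lra.
have combine (x y a e : R) : x <= a / 4 -> y <= a / 8 -> 0 < a -> e = 1 - a ->
  e < 1 - x - 2 * (a / 8) - y by lra.
by apply: combine h1 h2 d0 _; rewrite /d subKr.
Qed.

Lemma mixing_time_scale eps : 0 < eps < 1 -> exists c C : R, [/\ 0 < c, 0 < C &
  exists L0 : nat, forall L : nat, odd L -> (3 <= L)%N -> (L0 <= L)%N ->
  forall W : cyclic_srrw L alpha,
    ((c * sc L)%:E <= mixing_time W eps <= (C * sc L)%:E)%E].
Proof.
move=> e01; have [c c0 [L1 Hlow]] := tv_gt_below_scale e01.
have [A A0 [L2 Hup]] := scale_chi2 Hsc; have [L3 Hinf] := scale_large Hsc 1.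
case/andP: e01 => e0 e1.
have e2 : 0 < 4 * eps ^+ 2 by rewrite mulr_gt0 // exprn_gt0.
(* Beyond C0 sc(L), chi2 is at most 4 eps^2, hence the distance at most eps. *)
pose C0 := A / (4 * eps ^+ 2); have C00 : 0 < C0 by rewrite divr_gt0.
exists c, (C0 + 1); split => //; first by rewrite addr_gt0.
exists (maxn L1 (maxn L2 L3)) => -[|[|l]] // oL _; rewrite !geq_max => /and3P[l1 l2 l3] W.
have ol : odd l by move: oL; rewrite /= negbK.
have s1 := Hinf _ l3; have s0 : 0 < sc l.+2 by apply: lt_le_trans s1.
apply/andP; split; first by apply: mixing_time_ge => n n0 nc; apply: (Hlow l).
pose N := (Num.truncn (C0 * sc l.+2)).+1.
apply: (@le_trans _ _ N%:R%:E); last first.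
  rewrite lee_fin /N -natr1 mulrDl mul1r lerD // truncn_le mulr_ge0 //; exact: ltW.
apply: mixing_time_le => // m Nm.
have m0 : (0 < m)%N by apply: leq_trans Nm.
have mR : 0 < m%:R :> R by rewrite ltr0n.
have hm : C0 * sc l.+2 <= m%:R.
  by apply: le_trans (ltW (truncnS_gt _)) _; rewrite ler_nat.
have cT : (0 < #|'Z_l.+2|)%N by rewrite card_ord.
have hchi := Hup l ol l2 W m m0; rewrite /chi2 in hchi.
have := tv_sqr_le cT (sum_srrw_law W m0); rewrite card_ord => h.
have tv0 := tv_ge0 (srrw_law W m).
rewrite -(@ler_pXn2r _ 2) ?nnegrE ?(ltW e0) //.
rewrite -(ler_pM2l (_ : 0 < 4 :> R)) //.
apply: (le_trans h); apply: (le_trans hchi).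
rewrite ler_pdivrMr // -ler_pdivrMl //.
by rewrite mulrC mulrAC.
Qed.

(** The constant c bounds the eps-mixing time from below for every eps at most
    1/2; from time c sc(L) / 4 on the squared L2-distance is at most B, and eps is
    chosen from B by tv_le_overlap. *)
Lemma no_cutoff (W : forall k : nat, cyclic_srrw k.*2.+3 alpha) :
  ~ has_cutoff (fun k => mixing_time (W k)).
Proof.
move=> Hcut.
have half01 : 0 < (1 / 2 : R) < 1 by apply/andP; split; lra.
have [c c0 [L1 Hlow]] := tv_gt_below_scale half01.
have [A A0 [L2 Hup]] := scale_chi2 Hsc.
have [L3 Hinf] := scale_large Hsc (4 / c).
pose B := 4 * A / c; have B0 : 0 < B by rewrite divr_gt0 // mulr_gt0.
pose eps := 1 / (2 * (1 + B)).
have d0 : 0 < 2 * (1 + B) by rewrite mulr_gt0 // addr_gt0.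
have eps0 : 0 < eps by rewrite divr_gt0.
have epsh : eps <= 1 / 2 by rewrite ler_pdivrMr //; lra.
have eps01 : 0 < eps < 1 by rewrite eps0 /=; lra.
have Hev k : (maxn L1 (maxn L2 L3) <= k)%N ->
   (2%:E <= mixing_time (W k) eps / mixing_time (W k) (1 - eps)%R)%E.
  move=> Lk; have {Lk} : (maxn L1 (maxn L2 L3) <= k.*2.+1.+2)%N.
    by apply: (leq_trans Lk); do 3!apply: leqW; rewrite -addnn leq_addr.
  rewrite !geq_max => /and3P[l1 l2 l3].
  set l := k.*2.+1 in l1 l2 l3 *.
  have ol : odd l by rewrite /l /= odd_double.
  have s1 := Hinf _ l3; have c4 : 0 < 4 / c by rewrite divr_gt0.
  have s0 : 0 < sc l.+2 by apply: lt_le_trans s1.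
  have cs : 4 <= c * sc l.+2 by move: s1; rewrite ler_pdivrMr // mulrC.
  have lo : ((c * sc l.+2)%:E <= mixing_time (W k) eps)%E.
    apply: mixing_time_ge => n n0 nc; apply: (le_lt_trans epsh).
    exact: (Hlow l l1 (W k)).
  pose N := (Num.truncn (c / 4 * sc l.+2)).+1.
  have hi : (mixing_time (W k) (1 - eps)%R <= (c * sc l.+2 / 2)%:E)%E.
    apply: (@le_trans _ _ N%:R%:E); last first.
      rewrite lee_fin /N -natr1.
      have : (Num.truncn (c / 4 * sc l.+2))%:R <= c / 4 * sc l.+2.
        by rewrite truncn_le !mulr_ge0 ?invr_ge0 //; exact: ltW.
      by lra.
    apply: mixing_time_le => // m Nm.
    have m0 : (0 < m)%N by apply: leq_trans Nm.
    have mR : 0 < m%:R :> R by rewrite ltr0n.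
    have hm : c / 4 * sc l.+2 <= m%:R.
      by apply: le_trans (ltW (truncnS_gt _)) _; rewrite ler_nat.
    have cT : (0 < #|'Z_l.+2|)%N by rewrite card_ord.
    apply: (tv_le_overlap cT (srrw_law_ge0 (W k) m) (sum_srrw_law (W k) m0) (ltW B0)).
    rewrite card_ord; apply: le_trans (Hup l ol l2 (W k) m m0) _.
    rewrite ler_pdivrMr // /B.
    have -> : 4 * A / c * m%:R = A * (4 / c * m%:R) by ring.
    rewrite ler_pM2l //.
    have -> : sc l.+2 = 4 / c * (c / 4 * sc l.+2) by field; rewrite gt_eqF.
    by rewrite ler_pM2l.
  have ge1 := mixing_time_ge1 (W k) (1 - eps).
  move: lo hi ge1; set x := mixing_time _ eps; set y := mixing_time _ _.
  case: y => [r| |] //; rewrite !lee_fin => lo hi r1.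
  have r0 : 0 < r by apply: lt_le_trans r1.
  rewrite inver gt_eqF // lee_pdivlMr //.
  apply: le_trans lo; rewrite -EFinM lee_fin; lra.
have : (2%:E <= 1%:E :> \bar R)%E.
  apply: cvge_ge (Hcut eps eps01).
  by exists (maxn L1 (maxn L2 L3)) => // k /=; exact: Hev.
by rewrite lee_fin; lra.
Qed.

End Scale.

(** * The three scales *)

Section Scales.
Variables (R : realType) (alpha : R).
Hypothesis alpha01 : 0 <= alpha < 1.

Lemma nat_above (K : R) : exists L0 : nat, forall L, (L0 <= L)%N -> K <= L%:R.
Proof.
exists (Num.truncn K).+1 => L h; apply: le_trans (ltW (truncnS_gt _)) _.
by rewrite ler_nat.
Qed.

Lemma scale_const_gt0 : 0 < 4 * (350 * 200) / (1 - alpha).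
Proof.
apply: divr_gt0; last by rewrite subr_gt0; case/andP: alpha01.
by do ?apply: mulr_gt0; rewrite ltr0n.
Qed.

Lemma le_frac_pi l j : j%:R / l.+2%:R <= pi * j%:R / l.+2%:R :> R.
Proof.
rewrite -mulrA -[leLHS]mul1r ler_wpM2r ?divr_ge0 //.
by have := pi_ge2 R; lra.
Qed.

Lemma mixing_scale_diffusive : alpha < 2^-1 ->
  mixing_scale alpha (fun L => L%:R ^+ 2).
Proof.
move=> ah; split.
- move=> K; have [L0 H] := nat_above K; exists (maxn L0 1) => L; rewrite geq_max => /andP[h L1].
  apply: (le_trans (H L h)); rewrite expr2 -[leLHS]mul1r ler_wpM2r // ler1n //.
- have := scale_const_gt0; set K := (X in 0 < X) => K0.
  exists (4 * K); first by rewrite mulr_gt0.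
  exists 0%N => l ol _ W n n0.
  have nR : 0 < n%:R :> R by rewrite ltr0n.
  have LR : 0 < l.+2%:R :> R by rewrite ltr0n.
  have := @chi2_le R alpha alpha01 l W n (K * l.+2%:R ^+ 2 / n%:R) 2 n0 ol.
  move=> /(_ _ _ _)/le_trans; apply.
  + by rewrite divr_ge0 // mulr_ge0 ?sqr_ge0 // ltW.
  + by rewrite ltr1n.
  + move=> j theta j0 sl; apply: (le_trans (sine_like_sqr_char_le alpha01 n0 sl)).
    have jR : 0 < j%:R :> R by rewrite ltr0n.
    rewrite -/K powR_invn //.
    have jL : 0 < j%:R / l.+2%:R :> R by rewrite divr_gt0.
    apply: (@le_trans _ _ (K / (n%:R * (j%:R / l.+2%:R) ^+ 2))).
      apply: ler_wpM2l; first exact: ltW.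
      have x0 : 0 < pi * j%:R / l.+2%:R :> R := lt_le_trans jL (le_frac_pi l j).
      rewrite lef_pV2 ?posrE; try by apply: mulr_gt0 => //; apply: exprn_gt0.
      by rewrite ler_pM2l // lerXn2r ?nnegrE ?(ltW jL) ?(ltW x0) // le_frac_pi.
    by apply: eq_lerW; field; rewrite !gt_eqF.
  by apply: eq_lerW; field; rewrite gt_eqF.
- move=> eta eta0; have d0 : 0 < 1 - 2 * alpha by lra.
  set K := 2 / (1 - 2 * alpha); have K0 : 0 < K by rewrite divr_gt0.
  exists (eta / K); first by rewrite divr_gt0.
  exists 0%N => L n _ n0 hn; apply: (le_trans (window_mean_subcritical alpha01 n ah)).
  rewrite -/K mulrC -ler_pdivlMr //; apply: (le_trans hn).
  by apply: eq_lerW; rewrite mulrAC.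
Qed.

Lemma mixing_scale_superdiffusive : 2^-1 < alpha ->
  mixing_scale alpha (fun L => L%:R `^ alpha^-1).
Proof.
move=> ah; have a0 : 0 < alpha by apply: lt_trans ah; rewrite invr_gt0.
have a1 : alpha < 1 by case/andP: alpha01.
have q1 : 1 < alpha^-1 by rewrite invf_gt1.
split.
- move=> K; have [L0 H] := nat_above K; exists (maxn L0 1) => L; rewrite geq_max => /andP[h L1].
  apply: (le_trans (H L h)); apply: le1r_powR; [by rewrite ler1n|exact: ltW].
- have [K K0 HK] := sqr_char_superdiffusive alpha01 ah.
  set P := alpha^-1 / (alpha^-1 - 1).
  have P0 : 0 < P by rewrite divr_gt0 ?subr_gt0 ?invr_gt0.
  exists (2 * K * P); first by apply: mulr_gt0 => //; apply: mulr_gt0.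
  exists 0%N => l ol _ W n n0.
  have nR : 0 < n%:R :> R by rewrite ltr0n.
  have LR : 0 < l.+2%:R :> R by rewrite ltr0n.
  have := @chi2_le R alpha alpha01 l W n (K * l.+2%:R `^ alpha^-1 / n%:R) alpha^-1 n0 ol.
  move=> /(_ _ _ _)/le_trans; apply => //.
  + by rewrite divr_ge0 // mulr_ge0 ?powR_ge0 // ltW.
  + move=> j theta j0 sl; apply: (le_trans (HK _ _ _ n0 sl)).
    have jR : 0 < j%:R :> R by rewrite ltr0n.
    have jL : 0 < j%:R / l.+2%:R :> R by rewrite divr_gt0.
    have x0 : 0 < pi * j%:R / l.+2%:R :> R := lt_le_trans jL (le_frac_pi l j).
    apply: (@le_trans _ _ (K / (n%:R * (j%:R / l.+2%:R) `^ alpha^-1))).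
      apply: ler_wpM2l; first exact: ltW.
      rewrite lef_pV2 ?posrE; try by apply: mulr_gt0 => //; apply: powR_gt0.
      rewrite ler_pM2l //.
      apply: ge0_ler_powR; rewrite ?nnegrE ?invr_ge0 ?(ltW jL) ?(ltW x0) ?(ltW a0) //.
      exact: le_frac_pi.
    rewrite powRM ?invr_ge0 // -[l.+2%:R^-1]powR_inv1 // powRAC powR_inv1 ?powR_ge0 // powRN.
    have e1 : 0 < l.+2%:R `^ alpha^-1 :> R by apply: powR_gt0.
    have e2 : 0 < j%:R `^ alpha^-1 :> R by apply: powR_gt0.
    by move: (l.+2%:R `^ alpha^-1) (j%:R `^ alpha^-1) e1 e2 => y z y0 z0;
       apply: eq_lerW; field; rewrite !gt_eqF.
  by rewrite -/P; apply: eq_lerW; field; rewrite gt_eqF.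
- move=> eta eta0; have [C C0 HC] := window_mean_supercritical alpha01 ah.
  exists ((eta / C) `^ (alpha * 2)^-1); first by rewrite powR_gt0 // divr_gt0.
  exists 0%N => L n _ n0 hn; apply: (le_trans (HC n)).
  have a20 : 0 < alpha * 2 by rewrite mulr_gt0.
  have ec0 : 0 <= eta / C by rewrite divr_ge0 // ltW.
  rewrite -ler_pdivlMl // mulrA [C^-1 * _]mulrC.
  have -> : eta / C * L%:R ^+ 2 = ((eta / C) `^ (alpha * 2)^-1 * L%:R `^ alpha^-1) `^ (alpha * 2).
    rewrite powRM ?powR_ge0 // -!powRrM mulVf ?gt_eqF // powRr1 // mulrA mulVf ?gt_eqF //.
    by rewrite mul1r powR_mulrn.
  by apply: ge0_ler_powR => //; rewrite ?nnegrE ?mulr_ge0 ?powR_ge0 // ltW.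
Qed.

End Scales.

Section CriticalScale.
Variables (R : realType) (alpha : R).
Hypothesis alpha01 : 0 <= alpha < 1.
Hypothesis alpha_half : alpha = 2^-1.

(** With r the fourth root of L this reads 1600 + 64 r <= r^2, true for
    r >= 84. *)
Lemma log_vs_sqrt : exists L0 : nat, forall L : nat, (L0 <= L)%N ->
  1 <= ln (L%:R : R) /\ 16 * (100 + ln L%:R) <= Num.sqrt L%:R :> R.
Proof.
have [L1 H1] := nat_above ((84 ^+ 2) ^+ 2 : R).
have [L2 H2] := nat_above (expR 1 : R).
exists (maxn L1 L2) => L; rewrite geq_max => /andP[/H1 h1 /H2 h2].
have LR : 0 < L%:R :> R by apply: lt_le_trans h2; apply: expR_gt0.
split; first by rewrite -[leLHS]expRK ler_ln ?posrE ?expR_gt0.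
set s := Num.sqrt L%:R; have s0 : 0 < s by rewrite sqrtr_gt0.
have sE : L%:R = s * s by rewrite -expr2 sqr_sqrtr // ltW.
set r := Num.sqrt s; have r0 : 0 < r by rewrite sqrtr_gt0.
have rE : s = r * r by rewrite -expr2 sqr_sqrtr // ltW.
have s84 : 84 ^+ 2 <= s.
  have := ler_wsqrtr h1; rewrite sqrtr_sqr ger0_norm //; exact: sqr_ge0.
have r84 : 84 <= r.
  by have := ler_wsqrtr s84; rewrite sqrtr_sqr ger0_norm // ler0n.
have lr : ln r <= r by apply/ltW/ln_sublinear.
have -> : ln L%:R = 4 * ln r.
  by rewrite sE rE !lnM ?posrE ?mulr_gt0 //; ring.
rewrite rE; apply: (@le_trans _ _ (84 * r)); first by lra.
by rewrite ler_pM2r.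
Qed.

Lemma powR_three_halves (j : nat) : (0 < j)%N ->
  j%:R `^ (- (3 / 2)) = Num.sqrt j%:R / j%:R ^+ 2 :> R.
Proof.
move=> j0; have jR : 0 < j%:R :> R by rewrite ltr0n.
set w := Num.sqrt j%:R; have w0 : 0 < w by rewrite sqrtr_gt0.
have -> : j%:R = w ^+ 2 by rewrite sqr_sqrtr // ltW.
rewrite -powR_mulrn ?(ltW w0) // -powRrM.
have -> : 2%:R * - (3 / 2) = - 3%:R :> R by field.
rewrite powR_invn ?(ltW w0) // powR_mulrn ?(ltW w0) //.
by field; rewrite gt_eqF.
Qed.

(** For j^2 <= L the critical bound gives j^(-2); for larger j the general bound
    lacks the factor 1 / ln L, but then ln L is at most 4 sqrt j. Hence the
    exponent 3/2 in both cases. *)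
Lemma mixing_scale_critical : mixing_scale alpha (fun L => L%:R ^+ 2 / ln L%:R).
Proof.
have [Lb Hb] := log_vs_sqrt.
split.
- move=> K; have [L1 H1] := nat_above K; exists (maxn L1 (maxn Lb 1)) => L.
  rewrite !geq_max => /and3P[/H1 h1 /Hb[h2 _] L0]; apply: (le_trans h1).
  have LR : 0 < L%:R :> R by rewrite ltr0n.
  have l0 : 0 < ln L%:R :> R by apply: lt_le_trans h2.
  rewrite ler_pdivlMr // expr2 ler_pM2l //; exact/ltW/ln_sublinear.
- have := scale_const_gt0 alpha01; set K := (X in 0 < X) => K0.
  pose A := 4 * K + 32; have A0 : 0 < A by rewrite addr_gt0 // mulr_gt0.
  exists (2 * A * ((3 / 2) / (3 / 2 - 1))).
    apply: mulr_gt0; first by rewrite mulr_gt0.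
    by apply: divr_gt0; lra.
  exists Lb => l ol lb W n n0.
  have [ln1 lnb] := Hb _ lb.
  have nR : 0 < n%:R :> R by rewrite ltr0n.
  have LR : 0 < l.+2%:R :> R by rewrite ltr0n.
  set lg := ln (l.+2%:R : R) in ln1 lnb *; have lg0 : 0 < lg by apply: lt_le_trans ln1.
  have sc0 : 0 < l.+2%:R ^+ 2 / lg by rewrite divr_gt0 // exprn_gt0.
  have := @chi2_le R alpha alpha01 l W n (A * (l.+2%:R ^+ 2 / lg) / n%:R) (3 / 2) n0 ol.
  move=> /(_ _ _ _)/le_trans; apply.
  + by apply/ltW; apply: divr_gt0 => //; apply: mulr_gt0.
  + by lra.
  + move=> j theta j0 sl.
    have jR : 0 < j%:R :> R by rewrite ltr0n.
    have jL : 0 < j%:R / l.+2%:R :> R by rewrite divr_gt0.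
    have xj := le_frac_pi R l j.
    set x := pi * j%:R / l.+2%:R in sl xj *.
    have x0 : 0 < x := lt_le_trans jL xj.
    have x2 : (j%:R / l.+2%:R) ^+ 2 <= x ^+ 2 by rewrite lerXn2r ?nnegrE ?(ltW jL) ?(ltW x0).
    have jL2 : 0 < (j%:R / l.+2%:R) ^+ 2 :> R by rewrite exprn_gt0.
    have x20 : 0 < x ^+ 2 by rewrite exprn_gt0.
    rewrite powR_three_halves //; set w := Num.sqrt j%:R.
    have w0 : 0 < w by rewrite sqrtr_gt0.
    have w1 : 1 <= w by rewrite -[leLHS]sqrtr1 ler_wsqrtr // ler1n.
    have ww : j%:R = w * w by rewrite -expr2 sqr_sqrtr // ltW.
    have -> : A * (l.+2%:R ^+ 2 / lg) / n%:R * (w / j%:R ^+ 2) =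
        A * w / lg / (n%:R * (j%:R / l.+2%:R) ^+ 2).
      by field; rewrite !gt_eqF.
    have D0 : 0 < n%:R * (j%:R / l.+2%:R) ^+ 2 :> R by rewrite mulr_gt0.
    case: (leP (j%:R ^+ 2 : R) l.+2%:R) => jl.
      have x16 : x ^+ 2 <= 16 / l.+2%:R.
        have -> : x ^+ 2 = pi ^+ 2 * (j%:R ^+ 2 / l.+2%:R ^+ 2).
          by rewrite /x; field; rewrite gt_eqF.
        have p0 := pi_ge0 R; have p4 : pi <= 4 :> R by have := pihalf_lt2 R; lra.
        have p16 : pi ^+ 2 <= 16 :> R.
          have -> : 16 = 4 ^+ 2 :> R by lra.
          by rewrite lerXn2r ?nnegrE.
        apply: ler_pM; [exact: sqr_ge0|by apply: divr_ge0; apply: sqr_ge0|exact: p16|].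
        rewrite ler_pdivrMr ?exprn_gt0 // expr2 [X in _ <= _ * X]expr2 mulrA mulVf ?gt_eqF // mul1r.
        by rewrite -expr2.
      apply: (le_trans (sqr_char_critical alpha01 alpha_half n0 sl LR lg0 lnb x16)).
      rewrite -/lg.
      apply: (@le_trans _ _ (32 / lg / (n%:R * (j%:R / l.+2%:R) ^+ 2))).
        have -> : 32 / (n%:R * (x ^+ 2 * lg)) = 32 / lg / (n%:R * x ^+ 2).
          by field; rewrite !gt_eqF.
        apply: ler_wpM2l; first by rewrite divr_ge0 // ltW.
        by rewrite lef_pV2 ?posrE ?ler_pM2l // mulr_gt0.
      rewrite ler_pM2r ?invr_gt0 // ler_pM2r ?invr_gt0 //.
      apply: (@le_trans _ _ (A * 1)); last by rewrite ler_pM2l.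
      by rewrite mulr1 /A lerDr mulr_ge0 // ltW.
    apply: (le_trans (sine_like_sqr_char_le alpha01 n0 sl)); rewrite -/K.
    apply: (@le_trans _ _ (K / (n%:R * (j%:R / l.+2%:R) ^+ 2))).
      apply: ler_wpM2l; first exact: ltW.
      by rewrite lef_pV2 ?posrE ?ler_pM2l // mulr_gt0.
    rewrite ler_pM2r ?invr_gt0 // ler_pdivlMr //.
    have lw : lg <= 4 * w.
      apply: (@le_trans _ _ (ln (j%:R ^+ 2))).
        by rewrite ler_ln ?posrE ?exprn_gt0 // ltW.
      have -> : ln (j%:R ^+ 2 : R) = 4 * ln w.
        rewrite ww lnXn ?mulr_gt0 // lnM ?posrE // (mulr2n (_ + _)); ring.
      rewrite ler_pM2l //; exact/ltW/ln_sublinear.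
    apply: (@le_trans _ _ (K * (4 * w))); first by rewrite ler_pM2l.
    have -> : A * w = K * (4 * w) + 32 * w by rewrite /A; ring.
    by rewrite lerDl; apply: mulr_ge0 => //; exact: ltW.
  by apply: eq_lerW; field; rewrite !gt_eqF.
- move=> eta eta0; have e6 : 0 < 6 + eta by rewrite addr_gt0.
  exists (eta / (6 + eta)); first by rewrite divr_gt0.
  exists Lb => L n /Hb[ln1 _] n0 hn.
  have lg0 : 0 < ln L%:R :> R by apply: lt_le_trans ln1.
  have nR : 0 < n%:R :> R by rewrite ltr0n.
  have LR : 0 < L%:R :> R.
    by rewrite ltr0n lt0n; apply: contraTneq lg0 => ->; rewrite ln0 // ltxx.
  have L2 : 0 < L%:R ^+ 2 :> R by rewrite exprn_gt0.
  have sc0 : 0 <= L%:R ^+ 2 / ln L%:R :> R by rewrite divr_ge0 // ltW.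
  apply: (le_trans (window_mean_critical alpha01 alpha_half n0)).
  have c1 : eta / (6 + eta) <= 1 by rewrite ler_pdivrMr //; lra.
  have c6 : 6 * (eta / (6 + eta)) <= eta.
    by rewrite mulrA ler_pdivrMr //; have := sqr_ge0 eta; rewrite expr2; lra.
  have nL : n%:R <= L%:R ^+ 2 :> R.
    apply: (le_trans hn); apply: (@le_trans _ _ (1 * (L%:R ^+ 2 / ln L%:R))).
      exact: ler_wpM2r.
    by rewrite mul1r ler_pdivrMr // -[leLHS]mulr1 ler_pM2l.
  have lnn : ln n%:R <= 2 * ln L%:R :> R.
    have -> : 2 * ln L%:R = ln (L%:R ^+ 2) :> R by rewrite lnXn // mulr_natl.
    by rewrite ler_ln ?posrE.
  apply: (@le_trans _ _ (2 * n%:R * (3 * ln L%:R))).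
    by rewrite ler_pM2l ?mulr_gt0 //; move: lnn ln1; lra.
  apply: (@le_trans _ _ (2 * (eta / (6 + eta) * (L%:R ^+ 2 / ln L%:R)) * (3 * ln L%:R))).
    by rewrite ler_pM2r ?mulr_gt0 // ler_pM2l.
  have -> : 2 * (eta / (6 + eta) * (L%:R ^+ 2 / ln L%:R)) * (3 * ln L%:R) =
     6 * (eta / (6 + eta)) * L%:R ^+ 2 by field; rewrite !gt_eqF.
  by rewrite ler_pM2r.
Qed.

End CriticalScale.

Theorem theorem1p4 (R : realType) (alpha : R) (halpha : 0 <= alpha < 1) :
  (forall eps : R, 0 < eps < 1 ->
    [/\ alpha < 2^-1 ->
          exists c1 C1 : R, [/\ 0 < c1, 0 < C1 &
            exists L0 : nat, forall L : nat, odd L -> (3 <= L)%N ->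
              (L0 <= L)%N -> forall W : cyclic_srrw L alpha,
              ((c1 * L%:R ^+ 2)%:E <= mixing_time W eps
                 <= (C1 * L%:R ^+ 2)%:E)%E],
        alpha = 2^-1 ->
          exists c2 C2 : R, [/\ 0 < c2, 0 < C2 &
            exists L0 : nat, forall L : nat, odd L -> (3 <= L)%N ->
              (L0 <= L)%N -> forall W : cyclic_srrw L alpha,
              ((c2 * L%:R ^+ 2 / ln L%:R)%:E <= mixing_time W eps
                 <= (C2 * L%:R ^+ 2 / ln L%:R)%:E)%E]
      & 2^-1 < alpha ->
          exists c3 C3 : R, [/\ 0 < c3, 0 < C3 &
            exists L0 : nat, forall L : nat, odd L -> (3 <= L)%N ->
              (L0 <= L)%N -> forall W : cyclic_srrw L alpha,
              ((c3 * L%:R `^ (alpha^-1))%:E <= mixing_time W eps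
                 <= (C3 * L%:R `^ (alpha^-1))%:E)%E]]) /\
  (forall W : forall k : nat, cyclic_srrw k.*2.+3 alpha,
     ~ has_cutoff (fun k => mixing_time (W k))).
Proof.
split=> [eps eps01|W]; last first.
  case: (ltgtP alpha 2^-1) => h.
  - exact: no_cutoff (mixing_scale_diffusive halpha h) W.
  - exact: no_cutoff (mixing_scale_superdiffusive halpha h) W.
  - exact: no_cutoff (mixing_scale_critical halpha h) W.
split=> h.
- exact (mixing_time_scale halpha (mixing_scale_diffusive halpha h) eps01).
- have [c [C [c0 C0 [L0 H]]]] :=
    mixing_time_scale halpha (mixing_scale_critical halpha h) eps01.
  exists c, C; split=> //; exists L0 => L oL L3 LL W.
  by have := H L oL L3 LL W; rewrite !mulrA.
- exact (mixing_time_scale halpha (mixing_scale_superdiffusive halpha h) eps01).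
Qed.
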